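(* Suppose $A\in K(H)^+$ and $B\in E(\mathcal{U}(A))$. If \[ p=\min\{n\in\mathbb{N}\cup\{0,\infty\}\mid \operatorname{Tr}R_A^\perp\le\operatorname{Tr}R_B^\perp+n\}, \] then $s(B)\precsim_p s(A)$.
   Context: $H$ is a complex Hilbert space, finite dimensional or separable infinite dimensional, with a fixed orthonormal basis $\{e_n\}$. $K(H)^+$ is the set of positive (i.e. positive semidefinite) compact operators on $H$. $\mathcal{D}\subseteq B(H)$ is the algebra of operators that are diagonal with respect to $\{e_n\}$. $E:B(H)\to\mathcal{D}$ is the canonical conditional expectation: $E(X)$ is the diagonal operator with $\langle E(X)e_n,e_n\rangle=\langle Xe_n,e_n\rangle$ for all $n$. $\mathcal{U}(A)=\{UAU^*\mid U\in B(H)\text{ unitary}\}$ is the unitary orbit of $A$, and $E(\mathcal{U}(A))=\{E(X)\mid X\in\mathcal{U}(A)\}$. For self-adjoint $A$, $R_A$ is the orthogonal projection onto $\overline{\operatorname{ran}A}$ and $R_A^\perp=I-R_A$ is the projection onto $\ker A$, so $\operatorname{Tr}R_A^\perp=\dim\ker A\in\{0,1,2,\ldots\}\cup\{\infty\}$ (with $\infty\le\infty$ and $n+\infty=\infty$). For a positive compact operator $A$, $s(A)=(s_j(A))_{j\ge1}$ is the nonincreasing sequence of singular values of $A$: the nonzero eigenvalues listed in decreasing order with multiplicity, followed by zeros if $A$ has finite rank (and having no zeros if $A$ has infinite rank). For nonnegative nonincreasing sequences $\xi,\eta$ converging to $0$: - Majorization $\xi\prec\eta$ means $\sum_{j=1}^n\xi_j\le\sum_{j=1}^n\eta_j$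 for all $n\in\mathbb{N}$ and $\sum_{j=1}^\infty\xi_j=\sum_{j=1}^\infty\eta_j$ (both sums possibly $\infty$). - For an integer $0\le p<\infty$, approximate $p$-majorization $\xi\precsim_p\eta$ means $\xi\prec\eta$ and for every $\epsilon>0$ there exists $N_{p,\epsilon}\in\mathbb{N}$ such that $\sum_{k=1}^{n+p}\xi_k\le\sum_{k=1}^n\eta_k+\epsilon\,\eta_{n+1}$ for all $n\ge N_{p,\epsilon}$. - Approximate $\infty$-majorization $\xi\precsim_\infty\eta$ means $\xi\precsim_p\eta$ for all $p\in\mathbb{N}$ (equivalently, for infinitely many $p$). *)

(* Defs.v *)
From HB Require Import structures.
From mathcomp Require Export all_boot all_order all_algebra.
From mathcomp Require Export all_classical all_reals all_analysis.
From mathcomp Require Export sesquilinear complex.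

Set Implicit Arguments.
Unset Strict Implicit.
Unset Printing Implicit Defensive.

Export Order.TTheory GRing.Theory Num.Theory Num.Def.
Export numFieldNormedType.Exports.

Open Scope classical_set_scope.
Open Scope complex_scope.
Open Scope ring_scope.

(* A complex Hilbert space is a complete normed module H over R[i] together
   with a positive definite Hermitian form dot inducing its norm; dot is linear
   in its first argument and conjugate linear in the second one. *)
Definition induces_norm (R : realType) (H : completeNormedModType R[i])
    (dot : {dot H for conjC}) : Prop :=
  forall x : H, `|x| ^+ 2 = dot x x.

Section LinearAlgebra.
Context {R : realType} {H : completeNormedModType R[i]}.
Implicit Types (T : H -> H) (V : set H).

Definition linear_span (I : Type) (e : I -> H) : set H :=
  [set x | exists (s : seq I) (c : I -> R[i]), x = \sum_(i <- s) c i *: e i].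

Definition has_dim V (m : nat) : Prop :=
  exists b : 'I_m -> H,
    (forall c : 'I_m -> R[i],
       \sum_i c i *: b i = 0 -> forall i, c i = 0) /\
    V = linear_span b.

Definition eigenspace_op T (a : R[i]) : set H := [set x | T x = a *: x].

Definition bounded_op T : Prop := linear T /\ continuous T.

Definition compact_op T : Prop :=
  linear T /\ precompact (T @` [set x | `|x| <= 1]).

(* The defining property of s(T) for T compact and positive: the nonzero
   eigenvalues are listed in nonincreasing order, each one as many times as its
   multiplicity. The entries outside of this list have to be 0; there is none
   if T has infinite rank, because an entry 0 is only followed by entries 0. *)
Definition is_sing_seq T (s : R^nat) : Prop :=
  [/\ nonincreasing_seq s,
      forall n, 0 <= s n &
      forall a : R, 0 < a -> exists m : nat,
        has_dim (eigenspace_op T a%:C) m /\ ([set n | s n = a] #= `I_m)%card].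

(* s_1(T), s_2(T), ... are sing_vals T 0, sing_vals T 1, ... *)
Definition sing_vals T : R^nat := xget (fun=> 0) [set s | is_sing_seq T s].

End LinearAlgebra.

Section Hilbert.
Context {R : realType} {H : completeNormedModType R[i]}.
Variable dot : {dot H for conjC}.
Implicit Types (T X Y : H -> H) (V : set H).

Definition positive_op T : Prop := forall x, 0 <= dot (T x) x.

Definition is_adjoint T T' : Prop := forall x y, dot (T x) y = dot x (T' y).

Definition unitary_orbit T : set (H -> H) :=
  [set X | exists U U' : H -> H,
     [/\ bounded_op U, bounded_op U', is_adjoint U U',
         U \o U' = id /\ U' \o U = id & X = U \o T \o U']].

Definition orth_proj V (x : H) : H :=
  xget 0 [set y | V y /\ forall z, V z -> dot (x - y) z = 0].

Definition range_proj T : H -> H := orth_proj (closure (range T)).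

Definition range_proj_perp T : H -> H := fun x => x - range_proj T x.

Section Basis.
Variables (I : countType) (e : I -> H).

(* As I ranges over the countable types, finite ones included, H is either
   finite dimensional or separable and infinite dimensional. *)
Definition orthonormal_basis : Prop :=
  (forall i j, dot (e i) (e j) = (i == j)%:R) /\
  closure (linear_span e) = setT.

Definition diagonal_op T : Prop :=
  bounded_op T /\ forall i, exists c : R[i], T (e i) = c *: e i.

(* Y = E(X) *)
Definition is_cond_exp X Y : Prop :=
  diagonal_op Y /\ forall i, dot (Y (e i)) (e i) = dot (X (e i)) (e i).

(* E(U(T)) *)
Definition cond_exp_orbit T : set (H -> H) :=
  [set Y | exists2 X, unitary_orbit T X & is_cond_exp X Y].

(* Meant for positive T, whose diagonal entries are nonnegative reals. *)
Definition trace_op T : \bar R :=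
  (\esum_(i in [set: I]) (complex.Re (dot (T (e i)) (e i)))%:E)%E.

End Basis.
End Hilbert.

(* None stands for infinity. *)
Definition enat := option nat.

Definition enat_ereal (R : realType) (n : enat) : \bar R :=
  (if n is Some k then k%:R%:E else +oo)%E.

Definition is_min_enat (R : realType) (S : set enat) (p : enat) : Prop :=
  S p /\ forall q, S q -> (enat_ereal R p <= enat_ereal R q)%E.

Section Majorization.
Context {R : realType}.
Implicit Types xi eta : R^nat.

(* Sequences are indexed from 0: xi_j is xi j.-1. *)
Definition majorized xi eta : Prop :=
  (forall n : nat, \sum_(j < n) xi j <= \sum_(j < n) eta j) /\
  (\sum_(0 <= j <oo) (xi j)%:E = \sum_(0 <= j <oo) (eta j)%:E)%E.

Definition approx_majorized_fin (p : nat) xi eta : Prop :=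
  majorized xi eta /\
  forall eps : R, 0 < eps -> exists N : nat, forall n : nat, (N <= n)%N ->
    \sum_(k < n + p) xi k <= \sum_(k < n) eta k + eps * eta n.

Definition approx_majorized (p : enat) xi eta : Prop :=
  match p with
  | Some k => approx_majorized_fin k xi eta
  | None => forall k : nat, approx_majorized_fin k xi eta
  end.

End Majorization.

(* Main.v *)
From HB Require Import structures.
Require Import Defs.
From mathcomp Require Import finmap ring lra.

(* Eigenvectors f_0, f_1, ... of A are chosen greedily as maximisers of <Ax, x>;
   hence <Ax, x> <= s_n(A) |x|^2 for x orthogonal to f_0, ..., f_(n-1). Splitting a
   vector g along the f_j with j < n, along an orthonormal system (h) in ker A and
   along the rest, and summing over orthonormal g_0, ..., g_(m-1), this gives
     \sum_k <A g_k, g_k> <=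
       \sum_(j < n) s_j(A) + s_n(A) (m - n - \sum_k \sum_h |<g_k, h>|^2).
   If U is the unitary with B = E(U A U^* ), apply this to the vectors g_k = U^* e_i
   with i running through the indices of the m largest diagonal entries d_i of B.
   The empty system (h) and m = n give the majorization. If p > 0 then
   N = #{i | d_i = 0} = dim ker B is finite; for finite p take m = n + p and
   h_1, ..., h_(N + p) in ker A (if p is infinite, use each finite p). Their total mass
   on the basis U^* e_i is N + p, and the indices with d_i = 0 carry at most N of it;
   so for large n the double sum is at least p - eps. *)

Set Implicit Arguments.
Unset Strict Implicit.
Unset Printing Implicit Defensive.

(** * Inner products and orthonormal systems *)

Section InnerProduct.
Context {R : realType} {H : completeNormedModType R[i]}.
Variable dot : {dot H for conjC}.
Implicit Types (x y f g : H) (L : seq H).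
Local Notation "''[' x , y ]" := (dot x y) : ring_scope.

(* Squared moduli and norms are taken in R, where the order is total. *)
Definition csq (z : R[i]) : R := complex.Re z ^+ 2 + complex.Im z ^+ 2.
Definition nsq x : R := complex.Re '[x, x].

Lemma csqE z : (csq z)%:C = z * z^*.
Proof. by rewrite /csq add_Re2_Im2 normCK. Qed.

Lemma csq_ge0 z : 0 <= csq z.
Proof. by rewrite addr_ge0 ?sqr_ge0. Qed.

Lemma csq0 : csq 0 = 0.
Proof. by rewrite /csq /= expr0n addr0. Qed.

Lemma csq_eq0 z : csq z = 0 -> z = 0.
Proof.
move=> /(congr1 (real_complex R)); rewrite csqE -normCK => /eqP.
by rewrite sqrf_eq0 normr_eq0 => /eqP.
Qed.

Lemma csqM z w : csq (z * w) = csq z * csq w.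
Proof. by case: z w => [a b] [c d]; rewrite /csq /=; ring. Qed.

Lemma csqC (z : R[i]) : csq (z^*) = csq z.
Proof. by case: z => a b; rewrite /csq /= sqrrN. Qed.

Lemma csq_real (a : R) : csq a%:C = a ^+ 2.
Proof. by rewrite /csq /= expr0n addr0. Qed.

Lemma ReM_real (a : R) (z : R[i]) : complex.Re (a%:C * z) = a * complex.Re z.
Proof. by case: z => b c /=; ring. Qed.

Lemma ReC (z : R[i]) : complex.Re (z^*) = complex.Re z.
Proof. by case: z. Qed.

Lemma conj_realC (a : R) : (a%:C : R[i])^* = a%:C.
Proof. by rewrite conj_Creal// complex_real. Qed.

Lemma dotC x y : '[x, y] = '[y, x]^*.
Proof. by rewrite hermC mul1r. Qed.

Lemma dot_eq0C x y : '[x, y] = 0 -> '[y, x] = 0.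
Proof. by move=> xy0; rewrite dotC xy0 rmorph0. Qed.

Lemma dotZl a x y : '[a *: x, y] = a * '[x, y].
Proof. by rewrite linearZl_LR. Qed.

Lemma dotZr a x y : '[x, a *: y] = a^* * '[x, y].
Proof. by rewrite linearZr_LR. Qed.

Lemma dotDl x y z : '[x + y, z] = '[x, z] + '[y, z].
Proof. exact: linearDl. Qed.

Lemma dotDr x y z : '[z, x + y] = '[z, x] + '[z, y].
Proof. exact: linearDr. Qed.

Lemma dotBl x y z : '[x - y, z] = '[x, z] - '[y, z].
Proof. exact: linearBl. Qed.

Lemma dotBr x y z : '[z, x - y] = '[z, x] - '[z, y].
Proof. exact: linearBr. Qed.

Lemma dot0l x : '[0, x] = 0.
Proof. exact: linear0l. Qed.

Lemma dot0r x : '[x, 0] = 0.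
Proof. exact: linear0r. Qed.

Lemma dotNl x y : '[- x, y] = - '[x, y].
Proof. exact: linearNl. Qed.

Lemma dotNr x y : '[x, - y] = - '[x, y].
Proof. exact: linearNr. Qed.

Lemma dot_suml I (r : seq I) (F : I -> H) y :
  '[\sum_(i <- r) F i, y] = \sum_(i <- r) '[F i, y].
Proof. exact: linear_sumlz. Qed.

Lemma nsqE x : '[x, x] = (nsq x)%:C.
Proof. by rewrite RRe_real// ger0_real. Qed.

Lemma nsq_ge0 x : 0 <= nsq x.
Proof. by rewrite -(ler0c (nsq x)) -nsqE. Qed.

Lemma nsq0 : nsq 0 = 0.
Proof. by rewrite /nsq dot0l. Qed.

Lemma nsq_eq0 x : nsq x = 0 -> x = 0.
Proof. by move=> x0; apply/eqP; rewrite -(dnorm_eq0 dot) nsqE x0. Qed.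

Lemma nsqZ a x : nsq (a *: x) = csq a * nsq x.
Proof. by rewrite /nsq dotZl dotZr mulrA -csqE ReM_real. Qed.

Lemma nsqD x y : nsq (x + y) = nsq x + nsq y + complex.Re '[x, y] *+ 2.
Proof.
rewrite /nsq dotDl !dotDr (dotC y x) !raddfD /= ReC; ring.
Qed.

Lemma nsqN x : nsq (- x) = nsq x.
Proof. by rewrite /nsq dotNl dotNr opprK. Qed.

Lemma nsqB x y : nsq (x - y) = nsq x + nsq y - complex.Re '[x, y] *+ 2.
Proof. by rewrite nsqD nsqN dotNr raddfN mulNrn. Qed.

(* Zero vectors are allowed: they pad the eigenvectors of a finite rank operator. *)
Definition ons L : bool :=
  all (fun f => (f == 0) || (nsq f == 1)) L &&
  pairwise (fun f g => '[g, f] == 0) L.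

Definition proj L x : H := \sum_(f <- L) '[x, f] *: f.

Lemma ons_cons f L : ons (f :: L) =
  [&& (f == 0) || (nsq f == 1), all (fun g => '[g, f] == 0) L & ons L].
Proof. by rewrite /ons /= -!andbA; do !bool_congr. Qed.

Lemma ons_cat L1 L2 : ons (L1 ++ L2) =
  [&& ons L1, ons L2 & allrel (fun f g => '[g, f] == 0) L1 L2].
Proof. by rewrite /ons all_cat pairwise_cat -!andbA; do !bool_congr. Qed.

Lemma ons_map (J : eqType) (f : J -> H) (K : seq J) :
  (forall i, f i = 0 \/ nsq (f i) = 1) ->
  (forall i j, i != j -> '[f i, f j] = 0) -> uniq K -> ons (map f K).
Proof.
move=> f1 fo; elim: K => // k K IHK /= /andP[kK uK].
rewrite ons_cons IHK// andbT; apply/andP; split.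
  by case: (f1 k) => ->; rewrite eqxx ?orbT.
apply/allP => _ /mapP[j jK ->]; rewrite fo//.
by apply: contraNneq kK => <-.
Qed.

Lemma sum_mkseqE (u : nat -> H) (v : H -> R) n :
  \sum_(x <- mkseq u n) v x = \sum_(j < n) v (u j).
Proof.
by rewrite big_map -(big_mkord xpredT (fun j => v (u j))) /index_iota subn0.
Qed.

Lemma lt_orthogonal (f : nat -> H) :
  (forall i j, (i < j)%N -> '[f j, f i] = 0) ->
  forall i j, i != j -> '[f i, f j] = 0.
Proof.
by move=> fo i j; case: ltngtP => // ij _; [exact/dot_eq0C/fo|exact: fo].
Qed.

(** Since [L] is orthogonal to [f], removing the [f] component of [x] leaves its coefficients along
    [L] unchanged. The inductions on orthonormal systems rest on this. *)
Lemma proj_cons f L x : ons (f :: L) ->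
  x - proj (f :: L) x = (x - '[x, f] *: f) - proj L (x - '[x, f] *: f).
Proof.
rewrite ons_cons => /and3P[_ fL _]; rewrite /proj big_cons opprD addrA.
congr (_ - _); apply: eq_big_seq => g gL.
by rewrite dotBl dotZl (dot_eq0C (eqP (allP fL g gL))) mulr0 subr0.
Qed.

Lemma dot_subproj1 f x : (f == 0) || (nsq f == 1) ->
  '[x - '[x, f] *: f, f] = 0.
Proof.
case/orP => [/eqP->|/eqP f1]; first by rewrite dot0r.
by rewrite dotBl dotZl nsqE f1 mulr1 subrr.
Qed.

Lemma dot_subproj L x f : ons L -> f \in L -> '[x - proj L x, f] = 0.
Proof.
elim: L x => // g L IHL x onL; have := onL.
rewrite ons_cons inE => /and3P[g1 gL oL] /predU1P[->|fL]; rewrite proj_cons//.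
  rewrite dotBl dot_subproj1// sub0r dot_suml big_seq big1 ?oppr0// => h hL.
  by rewrite dotZl (eqP (allP gL _ hL)) mulr0.
exact: IHL.
Qed.

Lemma nsq_subproj L x : ons L ->
  nsq (x - proj L x) = nsq x - \sum_(f <- L) csq '[x, f].
Proof.
elim: L x => [|f L IHL] x onL; first by rewrite /proj !big_nil !subr0.
rewrite proj_cons// big_cons; move: onL; rewrite ons_cons => /and3P[f1 fL oL].
rewrite IHL// opprD addrA; congr (_ - _); last first.
  apply: eq_big_seq => g gL.
  by rewrite dotBl dotZl (dot_eq0C (eqP (allP fL g gL))) mulr0 subr0.
rewrite nsqB nsqZ dotZr ['[x, f]^* * _]mulrC -csqE.
case/orP: f1 => /eqP->; last by rewrite mulr1 /=; ring.
by rewrite dot0r csq0 nsq0 /= mulr0 addr0 mul0rn.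
Qed.

Lemma bessel L x : ons L -> \sum_(f <- L) csq '[x, f] <= nsq x.
Proof. by move=> oL; rewrite -subr_ge0 -nsq_subproj// nsq_ge0. Qed.

Lemma nsq_proj L x : ons L -> nsq (proj L x) = \sum_(f <- L) csq '[x, f].
Proof.
move=> oL; have pE f : f \in L -> '[proj L x, f] = '[x, f].
  by move=> fL; apply/esym/eqP; rewrite -subr_eq0 -dotBl dot_subproj.
have := nsq_subproj (proj L x) oL.
rewrite [X in _ - X]/proj (eq_big_seq (fun f => '[x, f] *: f)) => [|f /pE ->//].
rewrite subrr nsq0 => /esym/eqP; rewrite subr_eq0 => /eqP ->.
by apply: eq_big_seq => f /pE ->.
Qed.

(** The vector |y|^2 x - <x, y> y has squared norm |y|^2 (|x|^2 |y|^2 - |<x, y>|^2). *)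
Lemma cauchy_schwarz x y : csq '[x, y] <= nsq x * nsq y.
Proof.
have [->|y0] := eqVneq y 0; first by rewrite dot0r csq0 nsq0 mulr0.
have ny : 0 < nsq y.
  by rewrite lt_def nsq_ge0 andbT; apply: contra_neq y0; exact: nsq_eq0.
have := nsq_ge0 ((nsq y)%:C *: x - '[x, y] *: y).
rewrite nsqB !nsqZ dotZl dotZr ['[x, y]^* * _]mulrC -csqE -rmorphM /= csq_real => h.
by rewrite -subr_ge0 -(pmulr_rge0 _ ny); lra.
Qed.

End InnerProduct.

(** * Quadratic forms of positive operators *)

Section Operators.
Context {R : realType} {H : completeNormedModType R[i]}.
Variable dot : {dot H for conjC}.
Implicit Types (x y f g : H) (L : seq H).
Local Notation "''[' x , y ]" := (dot x y) : ring_scope.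
Local Notation nsq := (nsq dot).
Local Notation ons := (ons dot).

Definition qf (T : H -> H) x : R := complex.Re '[T x, x].

Definition candidate (C : set H) L : set H :=
  [set x | C x /\ forall f, f \in L -> '[x, f] = 0].

(** Each vector maximises [v] over the candidates orthogonal to the earlier ones, and is 0 once no
    candidate has positive value. The invariant [P] is available when the next maximiser is sought.
    Unit vectors will give the eigenvectors of A, basis vectors the sorted diagonal of B. *)
Lemma greedy_sequence (C P : set H) (v : H -> R) : P 0 -> v 0 = 0 ->
  (forall L, (forall f, f \in L -> P f) ->
    (exists x, candidate C L x /\ 0 < v x) ->
    exists x, [/\ candidate C L x, 0 < v x, P x &
      forall y, candidate C L y -> v y <= v x]) ->
  exists f : nat -> H, forall n, [/\ P (f n),
    f n = 0 \/ (C (f n) /\ 0 < v (f n)),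
    (forall i, (i < n)%N -> '[f n, f i] = 0) &
    forall y, C y -> (forall i, (i < n)%N -> '[y, f i] = 0) -> v y <= v (f n)].
Proof.
move=> P0 v0 hmax.
pose best L x := [/\ candidate C L x, 0 < v x, P x &
      forall y, candidate C L y -> v y <= v x].
pose next L : H := xget 0 [set x | best L x].
pose F n := iter n (fun L => rcons L (next L)) [::].
pose f n : H := next (F n).
have FE n : F n = mkseq f n by elim: n => // n IHn; rewrite mkseqS -IHn.
have memF n g : g \in F n -> exists2 i, (i < n)%N & g = f i.
  by rewrite FE /mkseq => /mapP[k]; rewrite mem_iota; exists k.
have nextP L : (forall f, f \in L -> P f) -> best L (next L) \/
    next L = 0 /\ forall y, candidate C L y -> v y <= 0.
  move=> LP; rewrite /next; case: xgetP => [x -> //|nbest]; first by left.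
  right; split=> // y yC; rewrite leNgt; apply/negP => y0.
  by have [|z] := hmax L LP; [exists y|move/nbest].
have fP n : P (f n).
  have [m] := ubnP n; elim: m n => // m IHm n; rewrite ltnS => nm.
  rewrite /f; have [g|[_ _ //]|[->//]] := nextP (F n).
  by move=> /memF[k ilt ->]; exact/IHm/(leq_trans ilt).
exists f => n; have FP g : g \in F n -> P g by move=> /memF[k _ ->].
have candF y : C y -> (forall i, (i < n)%N -> '[y, f i] = 0) ->
    candidate C (F n) y.
  by move=> Cy yf; split=> // _ /memF[k ilt ->]; exact: yf.
split=> //; have := nextP (F n) FP; rewrite -/(f n).
- by move=> [[[]]|[]]; [right|left].
- move=> [[[_ fo] _ _ _] i ilt|[-> _ i _]]; last by rewrite dot0l.
  by apply: fo; rewrite FE; apply: map_f; rewrite mem_iota.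
- by move=> [[_ _ _ fm]|[-> fm]] y Cy /(candF _ Cy)/fm//; rewrite v0.
Qed.

(** By the parallelogram law. Together with [nsqB_le] it stands in for the triangle inequality and
    keeps square roots away. *)
Lemma nsqD_le x y : nsq (x + y) <= nsq x *+ 2 + nsq y *+ 2.
Proof.
have := nsq_ge0 dot (x - y); rewrite nsqB nsqD; lra.
Qed.

Lemma nsqB_le x y z : nsq (x - z) <= nsq (x - y) *+ 2 + nsq (y - z) *+ 2.
Proof. by rewrite -[x - z](subrKA y) nsqD_le. Qed.

Lemma normalize x : x != 0 ->
  exists2 a : R, 0 < a & nsq (a%:C *: x) = 1.
Proof.
move=> x0; have nx : 0 < nsq x.
  by rewrite lt_def nsq_ge0 andbT; apply: contra_neq x0; exact: nsq_eq0.
exists (Num.sqrt (nsq x))^-1; first by rewrite invr_gt0 sqrtr_gt0.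
by rewrite nsqZ csq_real exprVn sqr_sqrtr ?nsq_ge0// mulVf ?gt_eqF.
Qed.

(** If a > 0, then d = 1 shows K > 0, and d = a / (2K) gives a <= a / 2. *)
Lemma le0_eps (a K : R) : (forall d, 0 < d -> a <= K * d) -> a <= 0.
Proof.
move=> aK; rewrite leNgt; apply/negP => a0.
have K0 : 0 < K by rewrite -[K]mulr1; apply: lt_le_trans a0 (aK 1 _).
have := aK (a / K / 2); rewrite !divr_gt0// => /(_ isT).
have -> : K * (a / K / 2) = a / 2 by field; exact: lt0r_neq0.
lra.
Qed.

Variable T : {linear H -> H}.
Local Notation q := (qf T).

Lemma qf0 : q 0 = 0.
Proof. by rewrite /qf dot0r. Qed.

Lemma qfZ a x : q (a *: x) = csq a * q x.
Proof.
rewrite /qf dotZr (linearZ_LR T) /= dotZl mulrA [_^* * _]mulrC -csqE.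
exact: ReM_real.
Qed.

Lemma qf_eig (M : R) x : T x = M%:C *: x -> q x = M * nsq x.
Proof. by move=> Tx; rewrite /qf Tx dotZl ReM_real. Qed.

Hypothesis Tpos : positive_op dot T.

Lemma qf_ge0 x : 0 <= q x.
Proof. by have := Tpos x; rewrite lecE => /andP[]. Qed.

(** Polarization: <Tz, z> is real at z = x + y and at z = x + iy, which settles the imaginary and
    the real part. *)
Lemma positive_selfadjoint x y : '[T x, y] = '[x, T y].
Proof.
have Im0 z : complex.Im '[T z, z] = 0 by rewrite ger0_Im.
have := Im0 (x + y); rewrite (linearD T) dotDl !dotDr !raddfD /= !Im0.
have := Im0 (x + 'i *: y).
rewrite (linearD T) dotDl !dotDr !raddfD /= !Im0 (linearZ_LR T) dotZl dotZr.
rewrite (dotC dot x (T y)); case: '[T x, y] '[T y, x] => [a b] [c d] /=.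
by move=> h1 h2; apply/eqP; rewrite eq_complex /=; apply/andP; split; apply/eqP; lra.
Qed.

Lemma qfB x y : q (x - y) = q x + q y - complex.Re '[T x, y] *+ 2.
Proof.
rewrite /qf (linearB T) dotBl !dotBr !raddfB /= [in RHS]mulr2n.
rewrite (positive_selfadjoint y x) (dotC dot y) ReC.
ring.
Qed.

(** There are no cross terms: [T] is selfadjoint and maps each [f] of [L] to a multiple of itself,
    so [T f] is orthogonal to the remainder. *)
Lemma qf_subproj L x : ons L -> (forall f, f \in L -> T f = (q f)%:C *: f) ->
  q x = \sum_(f <- L) q f * csq '[x, f] + q (x - proj dot L x).
Proof.
elim: L x => [|f L IHL] x onL eigL; first by rewrite /proj !big_nil add0r subr0.
have := onL; rewrite ons_cons => /and3P[_ fL oL].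
rewrite proj_cons// big_cons -addrA.
have -> : \sum_(g <- L) q g * csq '[x, g] =
    \sum_(g <- L) q g * csq '[x - '[x, f] *: f, g].
  apply: eq_big_seq => g gL.
  by rewrite dotBl dotZl (dot_eq0C (eqP (allP fL g gL))) mulr0 subr0.
rewrite -IHL//; last by move=> g gL; apply: eigL; rewrite inE gL orbT.
rewrite qfB qfZ dotZr positive_selfadjoint eigL ?mem_head// dotZr conj_realC.
rewrite mulrCA ['[x, f]^* * _]mulrC -csqE -rmorphM /=; ring.
Qed.

Lemma qf_le_proj L (M : R) x : ons L ->
  (forall f, f \in L -> T f = (q f)%:C *: f) ->
  (forall y, (forall f, f \in L -> '[y, f] = 0) -> q y <= M * nsq y) ->
  q x <= \sum_(f <- L) q f * csq '[x, f] +
         M * (nsq x - \sum_(f <- L) csq '[x, f]).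
Proof.
move=> oL eigL qM; rewrite (qf_subproj _ oL)// lerD2l -nsq_subproj//.
by apply: qM => f fL; rewrite dot_subproj.
Qed.

(** On the complement of [L] the operator S = M - T satisfies 0 <= S <= M, hence |Sx|^2 <= M <Sx,
    x>; the proof tests <Sz, z> >= 0 at z = x - Sx / M. Thus an almost maximiser of [q] is almost an
    eigenvector. *)
Lemma defect_le L (M : R) x : 0 < M ->
  (forall f, f \in L -> T f = (q f)%:C *: f) ->
  (forall y, (forall f, f \in L -> '[y, f] = 0) -> q y <= M * nsq y) ->
  (forall f, f \in L -> '[x, f] = 0) ->
  nsq (M%:C *: x - T x) <= M * (M * nsq x - q x).
Proof.
move=> M0 eigL qM xL; set w := M%:C *: x - T x.
have wL f : f \in L -> '[w, f] = 0.
  move=> fL; rewrite dotBl dotZl xL// mulr0 positive_selfadjoint eigL// dotZr.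
  by rewrite xL// mulr0 subr0.
have zL f : f \in L -> '[x - (M^-1)%:C *: w, f] = 0.
  by move=> fL; rewrite dotBl dotZl xL// wL// mulr0 subr0.
have := qM _ zL; rewrite qfB nsqB nsqZ qfZ csq_real !dotZr !conj_realC !ReM_real.
have -> : complex.Re '[T x, w] = M * complex.Re '[x, w] - nsq w.
  have : complex.Re '[M%:C *: x - T x, w] = nsq w by [].
  by rewrite dotBl dotZl raddfB /= ReM_real => <-; ring.
have := qf_ge0 w; rewrite exprVn; move: (q w) (nsq w) (q x) (nsq x) => a b c d.
move: (complex.Re _) => e a0 h.
(* Here a, b, c, d, e stand for q w, |w|^2, q x, |x|^2 and Re <x, w>. *)
have : b / M <= M * d - c.
  have : 0 <= M ^- 2 * a by rewrite mulr_ge0// invr_ge0 sqr_ge0.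
  have -> : b / M = (M^-1 * b) *+ 2 - M * (M ^- 2 * b).
    by field; exact: lt0r_neq0.
  have : M * (M^-1 * e) = e by field; exact: lt0r_neq0.
  have : M^-1 * (M * e - b) = e - M^-1 * b by field; exact: lt0r_neq0.
  lra.
by rewrite ler_pdivrMr// mulrC.
Qed.

End Operators.

(** * The eigenvectors of a compact positive operator *)

Section Compactness.
Context {R : realType} {H : completeNormedModType R[i]}.
Variable dot : {dot H for conjC}.
Implicit Types (x y f g : H) (L : seq H).
Local Notation "''[' x , y ]" := (dot x y) : ring_scope.
Local Notation nsq := (nsq dot).
Local Notation ons := (ons dot).
Hypothesis dot_norm : induces_norm dot.

Lemma normr_nsq x : `|x| = (Num.sqrt (nsq x))%:C.
Proof.
apply/eqP; rewrite -(@eqrXn2 _ 2)// ?ler0c ?sqrtr_ge0//.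
by rewrite dot_norm -rmorphXn /= sqr_sqrtr ?nsq_ge0// nsqE.
Qed.

Lemma normr_lt x (r : R) : 0 < r -> (`|x| < r%:C) = (nsq x < r ^+ 2).
Proof.
move=> r0; rewrite normr_nsq ltcR -[in RHS](sqr_sqrtr (nsq_ge0 dot x)).
by rewrite ltr_pXn2r// ?nnegrE ?sqrtr_ge0 ?ltW.
Qed.

Lemma nbhs_nsq x (e : R) : 0 < e -> nbhs x [set y | nsq (x - y) < e].
Proof.
move=> e0; have s0 : 0 < Num.sqrt e by rewrite sqrtr_gt0.
have := @nbhsx_ballx _ _ x (Num.sqrt e)%:C; rewrite ltcR => /(_ s0).
apply: filterS => y; rewrite -ball_normE /= normr_lt//.
by rewrite sqr_sqrtr ?ltW.
Qed.

Lemma nsq_nbhs x (A : set H) : nbhs x A ->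
  exists2 e : R, 0 < e & forall y, nsq (x - y) < e -> A y.
Proof.
move=> /nbhs_ballP[[a b] /= ab0 aA].
(* Radii live in R[i]: a positive one has positive real part and imaginary part 0. *)
have : 0 < a by move: ab0; rewrite ltcE /= => /andP[].
have b0 : b = 0 by move: ab0; rewrite ltcE /= => /andP[/eqP].
move=> a0; exists (a ^+ 2); first by rewrite exprn_gt0.
by move=> y xy; apply: aA; rewrite -ball_normE /= b0 complexr0 normr_lt.
Qed.

Lemma nsqBC x y : nsq (x - y) = nsq (y - x).
Proof. by rewrite -nsqN opprB. Qed.

(** A compact set contains all T (u n); a cluster point replaces the limit of a subsequence. *)
Lemma compact_cluster (T : H -> H) (u : nat -> H) : compact_op T ->
  (forall n, nsq (u n) <= 1) ->
  exists y, forall e : R, 0 < e -> forall N : nat,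
    exists2 n, (N <= n)%N & nsq (T (u n) - y) < e.
Proof.
move=> [_ [B TB [Bc _]]] u1.
have [|y [_ yc]] := Bc ((T \o u) @ \oo) _.
  exists 0%N => // n _; apply: TB; exists (u n) => //=.
  by rewrite normr_nsq lecR -sqrtr1 ler_wsqrtr.
exists y => e e0 N.
have [||z [[n Nn <-]]] := yc [set T (u n) | n in [set n | (N <= n)%N]]
    [set z | nsq (y - z) < e].
- by exists N => // n Nn; exists n.
- exact: nbhs_nsq.
- by move=> /= ny; exists n => //; rewrite nsqBC.
Qed.

Lemma compact_bounded (T : {linear H -> H}) : compact_op T ->
  exists2 K : R, 0 < K & forall x, nsq (T x) <= K * nsq x.
Proof.
move=> Tc; apply: contrapT => nK.
have h (n : nat) : exists x, nsq x <= 1 /\ n%:R <= nsq (T x).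
  apply: contrapT => nx; apply: nK; exists n.+1%:R => // x.
  have [->|x0] := eqVneq x 0; first by rewrite linear0 nsq0 mulr0.
  have [a a0 ax1] := normalize dot x0.
  rewrite leNgt; apply/negP => xn; apply: nx; exists (a%:C *: x).
  rewrite ax1 (linearZ_LR T) /= nsqZ csq_real; split=> //.
  apply: (@le_trans _ _ n.+1%:R); first by rewrite ler_nat.
  move: ax1; rewrite nsqZ csq_real => ax1.
  have -> : n.+1%:R = a ^+ 2 * (n.+1%:R * nsq x) by rewrite mulrCA ax1 mulr1.
  by rewrite ler_wpM2l ?sqr_ge0// ltW.
have [u uP] := choice h.
have [y yP] := compact_cluster Tc (fun n => (uP n).1).
(* If |T (u n) - y|^2 < 1 then |T (u n)|^2 < 2 + 2|y|^2, which fails for n beyond that number. *)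
have [n] := yP 1 ltr01 (Num.truncn (2 + nsq y *+ 2)).+1.
move=> nN ny; have := nsqD_le dot (T (u n) - y) y; rewrite subrK.
have := (uP n).2; have : (2 + nsq y *+ 2) < n%:R.
  by apply: lt_le_trans (truncnS_gt _) _; rewrite ler_nat.
lra.
Qed.

Section Spectral.
Variable T : {linear H -> H}.
Hypotheses (Tc : compact_op T) (Tpos : positive_op dot T).
Local Notation q := (qf dot T).

Definition eigenvector x : Prop := T x = (q x)%:C *: x.

Lemma qf_le_unit L (M : R) :
  (forall y, candidate dot [set x | nsq x = 1] L y -> q y <= M) ->
  forall y, (forall f, f \in L -> '[y, f] = 0) -> q y <= M * nsq y.
Proof.
move=> hM y yL; have [->|y0] := eqVneq y 0.
  by rewrite qf0 nsq0 mulr0.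
have [a a0 ay1] := normalize dot y0.
have /hM : candidate dot [set x | nsq x = 1] L (a%:C *: y).
  by split=> // f fL; rewrite dotZl yL// mulr0.
move: ay1; rewrite qfZ nsqZ csq_real => ay1 h.
have a2 : 0 < a ^+ 2 by rewrite exprn_gt0.
by rewrite -(ler_pM2l a2) mulrCA ay1 mulr1.
Qed.

(** Let M be the supremum of [q] on the candidates and u_n a maximising sequence. By [defect_le], M
    u_n - T u_n tends to 0; since T u_n clusters at some y, u_n clusters at z = y / M, an
    eigenvector for M, which is then normalised. *)
Lemma compact_max L : (forall f, f \in L -> eigenvector f) ->
  (exists x, candidate dot [set x | nsq x = 1] L x /\ 0 < q x) ->
  exists x, [/\ candidate dot [set x | nsq x = 1] L x, 0 < q x, eigenvector x &
    forall y, candidate dot [set x | nsq x = 1] L y -> q y <= q x].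
Proof.
move=> eigL [x0 [Cx0 qx0]].
set C := candidate _ _ _ in Cx0 *.
have [K K0 KT] := compact_bounded Tc.
(* From q(x)^2 <= K and 2 q(x) <= q(x)^2 + 1. *)
have qK x : C x -> q x <= K + 1.
  move=> [/= x1 _]; have := cauchy_schwarz dot (T x) x.
  rewrite x1 mulr1 => h; have {h} : csq '[T x, x] <= K.
    by apply: le_trans h _; have := KT x; rewrite x1 mulr1.
  rewrite /csq -/(q x) => h; have := sqr_ge0 (complex.Im '[T x, x]).
  have := sqr_ge0 (q x - 1); rewrite sqrrB1; have := qf_ge0 Tpos x.
  nra.
pose S := [set q x | x in C].
have supS : has_sup S.
  by split; [exists (q x0), x0|exists (K + 1) => _ [x Cx <-]; exact: qK].
set M := sup S.
have M0 : 0 < M.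
  by apply: lt_le_trans qx0 _; apply: ub_le_sup; [case: supS|exists x0].
have CM y : C y -> q y <= M.
  by move=> Cy; apply: ub_le_sup; [case: supS|exists y].
have qM := qf_le_unit CM.
have h (n : nat) : exists x, C x /\ M - n.+1%:R^-1 < q x.
  have [|_ [x Cx <-] xM] := @sup_adherent _ S n.+1%:R^-1 _ supS.
    by rewrite invr_gt0.
  by exists x.
have [u uP] := choice h.
have [|y yP] := @compact_cluster T u Tc; first by move=> n; rewrite (uP n).1.1.
pose z := (M^-1)%:C *: y.
have zP d : 0 < d -> exists x, [/\ C x, M - d < q x & nsq (x - z) <= d].
  (* The second bound on e is what remains after |M u_n - y|^2 <= e (2 + 2M) is divided by M^2. *)
  move=> d0; pose e := minr d (d * M ^+ 2 / (2 + M *+ 2)).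
  have P0 : 0 < 2 + M *+ 2 by rewrite addr_gt0// pmulrn_lgt0.
  have e0 : 0 < e.
    by rewrite lt_min d0 divr_gt0// mulr_gt0// exprn_gt0.
  have [n nN ny] := yP e e0 (Num.truncn e^-1).
  have ne : n.+1%:R^-1 <= e.
    rewrite -[e]invrK lef_pV2 ?posrE ?invr_gt0//; apply/ltW.
    by apply: lt_le_trans (truncnS_gt _) _; rewrite ler_nat.
  have [Cu qu] := uP n; exists (u n).
  have qe : M - e < q (u n) by apply: le_lt_trans qu; rewrite lerD2l lerN2.
  split=> //; first by apply: le_lt_trans qe; rewrite lerD2l lerN2 ge_min lexx.
  have Muy : nsq (M%:C *: u n - y) <= (M * e + e) *+ 2.
    apply: le_trans (nsqB_le dot _ (T (u n)) _) _.
    rewrite -mulrnDl lerMn2r /= lerD ?(ltW ny)//.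
    apply: le_trans (defect_le Tpos M0 eigL qM Cu.2) _.
    rewrite ler_pM2l// Cu.1 mulr1; lra.
  have -> : u n - z = (M^-1)%:C *: (M%:C *: u n - y).
    by rewrite scalerBr scalerA -rmorphM /= mulVf ?gt_eqF// scale1r.
  rewrite nsqZ csq_real exprVn mulrC ler_pdivrMr ?exprn_gt0//.
  apply: le_trans Muy _.
  have : e * (2 + M *+ 2) <= d * M ^+ 2.
    by rewrite -ler_pdivlMr// ge_min lexx orbT.
  lra.
have z0 : z != 0.
  apply/eqP => z0; have [|x [[/= x1 _] _]] := zP (2^-1); first by rewrite invr_gt0.
  rewrite z0 subr0 x1; lra.
have zL f : f \in L -> '[z, f] = 0.
  move=> fL; apply: csq_eq0; apply/eqP; rewrite eq_le csq_ge0 andbT.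
  apply: (@le0_eps _ _ (nsq f)) => d /zP[x [Cx _ xz]].
  have -> : '[z, f] = '[z - x, f] by rewrite dotBl (Cx.2 _ fL) subr0.
  apply: le_trans (cauchy_schwarz _ _ _) _.
  by rewrite mulrC ler_wpM2l ?nsq_ge0// nsqBC.
have Tz : T z = M%:C *: z.
  apply/eqP; rewrite -subr_eq0; apply/eqP; apply: (@nsq_eq0 _ _ dot); apply/eqP.
  rewrite eq_le nsq_ge0 andbT.
  (* Two uses of [nsqB_le] along T z, T x, M x, M z give 2 K d + 2 (2 M d + 2 M^2 d). *)
  apply: (@le0_eps _ _ (K *+ 2 + M *+ 4 + M ^+ 2 *+ 4)) => d d0.
  have [x [Cx qx xz]] := zP _ d0.
  have h1 : nsq (T z - T x) <= K * d.
    rewrite -linearB; apply: le_trans (KT _) _.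
    by rewrite ler_pM2l// nsqBC.
  have h2 : nsq (T x - M%:C *: x) <= M * d.
    rewrite nsqBC; apply: le_trans (defect_le Tpos M0 eigL qM Cx.2) _.
    rewrite ler_pM2l// Cx.1 mulr1; lra.
  have h3 : nsq (M%:C *: x - M%:C *: z) <= M ^+ 2 * d.
    by rewrite -scalerBr nsqZ csq_real ler_wpM2l// sqr_ge0.
  have := nsqB_le dot (T z) (T x) (M%:C *: z).
  have := nsqB_le dot (T x) (M%:C *: x) (M%:C *: z).
  lra.
have [a a0 az1] := normalize dot z0.
have Tw : T (a%:C *: z) = M%:C *: (a%:C *: z).
  by rewrite (linearZ_LR T) /= Tz scalerA mulrC -scalerA.
have qw : q (a%:C *: z) = M by rewrite (qf_eig dot Tw) az1 mulr1.
exists (a%:C *: z); split.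
- by split=> // f fL; rewrite dotZl zL// mulr0.
- by rewrite qw.
- by rewrite /eigenvector qw.
- by rewrite qw.
Qed.

(** In finite rank the sequence continues with zeros; where f n = 0, the last clause says that [q]
    is at most 0 on the complement of the earlier vectors. *)
Lemma spectral_sequence : exists f : nat -> H,
  [/\ forall n, eigenvector (f n),
      forall n, f n = 0 \/ nsq (f n) = 1,
      forall n, q (f n) = 0 -> f n = 0,
      forall i j, (i < j)%N -> '[f j, f i] = 0 &
      forall n y, (forall i, (i < n)%N -> '[y, f i] = 0) ->
        q y <= q (f n) * nsq y].
Proof.
have [|||f fP] := @greedy_sequence _ _ dot [set x | nsq x = 1] eigenvector q.
- by rewrite /eigenvector linear0 scaler0.
- exact: qf0.
- exact: compact_max.
exists f; split=> [n|n|n qn0|i j ij|n y yf].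
- by have [] := fP n.
- by have [_ [|[]]] := fP n; [left|right].
- by have [_ [//|[_ +]] _ _] := fP n; rewrite qn0 ltxx.
- by have [_ _ + _] := fP j; apply.
- apply: (@qf_le_unit (mkseq f n)) => [z [z1 zL]|g].
    have [_ _ _] := fP n; apply=> // i ilt; apply: zL.
    by apply: map_f; rewrite mem_iota.
  by rewrite /mkseq => /mapP[k]; rewrite mem_iota => klt ->; exact: yf.
Qed.

(** Otherwise the T (f n) would eventually be orthogonal of norm at least a, hence at squared
    distance at least 2a^2. Two of them within squared distance a^2 / 2 of a cluster point
    contradict this. *)
Lemma orthogonal_eigenvalues_small (f : nat -> H) :
  (forall n, eigenvector (f n)) -> (forall n, f n = 0 \/ nsq (f n) = 1) ->
  (forall i j, (i < j)%N -> '[f j, f i] = 0) ->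
  forall a : R, 0 < a -> forall N, exists2 n, (N <= n)%N & q (f n) < a.
Proof.
move=> eigf f1 fo a a0 N; apply: contrapT => nN.
have qa n : (N <= n)%N -> a <= q (f n).
  by move=> Nn; rewrite leNgt; apply/negP => h; apply: nN; exists n.
have fn1 n : nsq (f n) <= 1 by case: (f1 n) => ->//; rewrite nsq0.
have [y yP] := compact_cluster Tc fn1.
have e0 : 0 < a ^+ 2 / 2 by rewrite divr_gt0// exprn_gt0.
have [n Nn ny] := yP _ e0 N; have [m nm my] := yP _ e0 n.+1.
have Nm : (N <= m)%N by rewrite (leq_trans Nn)// ltnW.
have f1' k : (N <= k)%N -> nsq (f k) = 1.
  move=> Nk; case: (f1 k) => // fk; have := qa k Nk.
  by rewrite fk qf0 leNgt a0.
have : nsq (T (f n) - T (f m)) = q (f n) ^+ 2 + q (f m) ^+ 2.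
  rewrite !eigf nsqB !nsqZ !csq_real !f1'// !mulr1 dotZl dotZr.
  by rewrite (dot_eq0C (fo _ _ nm)) !mulr0 /= mul0rn subr0.
have := nsqB_le dot (T (f n)) y (T (f m)); rewrite (nsqBC y) => h hE.
have : a ^+ 2 <= q (f n) ^+ 2 by rewrite lerXn2r ?nnegrE ?qf_ge0 ?(ltW a0) ?qa.
have : a ^+ 2 <= q (f m) ^+ 2 by rewrite lerXn2r ?nnegrE ?qf_ge0 ?(ltW a0) ?qa.
lra.
Qed.

End Spectral.
End Compactness.

(** * Singular value sequences *)

Section SingularSequences.
Context {R : realType} {H : completeNormedModType R[i]}.

Lemma linear_span_ord (m : nat) (b : 'I_m -> H) x :
  linear_span b x -> exists c : 'I_m -> R[i], x = \sum_i c i *: b i.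
Proof.
move=> [s [c ->]]; elim: s => [|j s [d dE]].
  by exists (fun=> 0); rewrite big_nil big1// => i _; rewrite scale0r.
exists (fun i => (if i == j then c j else 0) + d i).
rewrite big_cons dE; under [RHS]eq_bigr do rewrite scalerDl.
rewrite big_split /=; congr (_ + _).
rewrite (bigD1 j)//= eqxx big1 ?addr0// => i /negbTE ->.
by rewrite scale0r.
Qed.

(** If n < m, the m by n matrix of coefficients of [b] in terms of [b'] has a nonzero left kernel
    vector, that is, a linear relation among the [b i]. *)
Lemma has_dim_le (V : set H) m n : has_dim V m -> has_dim V n -> (m <= n)%N.
Proof.
move=> [b [b_free VE]] [b' [_ VE']]; rewrite leqNgt; apply/negP => nm.
have bV i : exists c : 'I_n -> R[i], b i = \sum_j c j *: b' j.
  apply: linear_span_ord; rewrite -VE' VE.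
  by exists [:: i], (fun=> 1); rewrite big_seq1 scale1r.
have [M ME] := choice bV; pose A := \matrix_(i, j) M i j.
have : kermx A != 0.
  rewrite kermx_eq0 /row_free; apply: contraTN nm => /eqP <-.
  by rewrite -leqNgt rank_leq_col.
move=> /rowV0Pn[v /sub_kermxP vA]; apply/negP; rewrite negbK.
apply/eqP/rowP => i; rewrite mxE; apply: (b_free (v 0)).
under eq_bigr do rewrite ME scaler_sumr.
rewrite exchange_big big1//= => j _.
under eq_bigr do rewrite scalerA.
rewrite -scaler_suml; have /matrixP/(_ 0 j) := vA.
rewrite !mxE => vAj; rewrite (_ : \sum_i _ = 0) ?scale0r//.
by rewrite -[RHS]vAj; apply: eq_bigr => k _; rewrite mxE.
Qed.

Lemma has_dim_inj (V : set H) m n : has_dim V m -> has_dim V n -> m = n.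
Proof.
move=> Vm Vn; apply/eqP.
by rewrite eqn_leq (has_dim_le Vm Vn) (has_dim_le Vn Vm).
Qed.

(** Suppose t' n < t n = a at the first difference. By monotonicity t' takes the value a only before
    n, where it agrees with t. So {t' = a} is contained in {t = a} and misses n, although both have
    the same size. *)
Lemma is_sing_seq_unique (T : H -> H) s s' :
  is_sing_seq T s -> is_sing_seq T s' -> s = s'.
Proof.
suff aux t t' n : is_sing_seq T t -> is_sing_seq T t' ->
    (forall k, (k < n)%N -> t k = t' k) -> t n <= t' n.
  move=> sT s'T; apply/funext => n; have [m] := ubnP n.
  elim: m n => // m IHm n; rewrite ltnS => nm.
  have IH k : (k < n)%N -> s k = s' k by move=> kn; exact/IHm/(leq_trans kn).
  by apply/eqP; rewrite eq_le !aux// => k /IH.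
move=> [t_dec t_ge0 tT] [t'_dec t'_ge0 t'T] tt'; rewrite leNgt; apply/negP => tn.
have t0 : 0 < t n by exact: le_lt_trans tn.
have [m [Vm Am]] := tT _ t0; have [m' [Vm' Am']] := t'T _ t0.
have mm' := has_dim_inj Vm Vm'; rewrite -{}mm' in Am'.
have sub : [set k | t' k = t n] `<=` [set k | t k = t n].
  move=> k /= t'k; rewrite -t'k tt'// ltnNge; apply/negP => nk.
  by have := t'_dec _ _ nk; rewrite t'k leNgt tn.
have /finite_fsetP[X XE] : finite_set [set k | t k = t n] by exists m.
have /finite_fsetP[X' XE'] : finite_set [set k | t' k = t n] by exists m.
rewrite XE in Am sub; rewrite XE' in Am' sub.
move: Am Am' => /card_eq_fsetP Xm /card_eq_fsetP Xm'.
have : X' == X.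
  by rewrite eqEfcard Xm Xm' leqnn andbT; apply/fsubsetP => k /sub.
move=> /eqP XX'; have : [set` X'] n by rewrite XX' -XE.
by rewrite -XE' /= => t'n; rewrite t'n ltxx in tn.
Qed.

Lemma sing_valsE (T : H -> H) s : is_sing_seq T s -> sing_vals T = s.
Proof.
by move=> sT; apply/(is_sing_seq_unique _ sT)/(xgetPex _ (P := is_sing_seq T)); exists s.
Qed.

Variable dot : {dot H for conjC}.
Local Notation "''[' x , y ]" := (dot x y) : ring_scope.
Local Notation nsq := (nsq dot).

(** Common criterion for A and for B. As s tends to 0, only finitely many n have s n = a, and their
    f n form a basis of the eigenspace of a: what they leave of an eigenvector is orthogonal to all
    f n, hence 0. *)
Lemma is_sing_seq_eigenvectors (T : {linear H -> H}) (f : nat -> H) (s : R^nat) :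
  nonincreasing_seq s -> (forall n, 0 <= s n) ->
  (forall a, 0 < a -> exists n, s n < a) ->
  (forall n, T (f n) = (s n)%:C *: f n) ->
  (forall n x, '[T x, f n] = (s n)%:C * '[x, f n]) ->
  (forall n, 0 < s n -> nsq (f n) = 1) ->
  (forall n, f n = 0 \/ nsq (f n) = 1) ->
  (forall i j, (i < j)%N -> '[f j, f i] = 0) ->
  (forall (a : R) x, 0 < a -> T x = a%:C *: x -> (forall n, '[x, f n] = 0) -> x = 0) ->
  is_sing_seq T s.
Proof.
move=> s_dec s_ge0 s_small Tf Tsym f1 f01 fo f_complete; split=> // a a0.
have [N sN] := s_small a a0.
have ltN n : s n = a -> (n < N)%N.
  move=> sna; rewrite ltnNge; apply/negP => Nn.
  by have := s_dec _ _ Nn; rewrite sna leNgt sN.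
have fo' := lt_orthogonal fo.
pose K := [seq n <- iota 0 N | s n == a].
have memK n : (n \in K) = (s n == a).
  rewrite mem_filter mem_iota add0n /= andb_idr// => /eqP; exact: ltN.
have uK : uniq K by rewrite filter_uniq// iota_uniq.
exists (size K); split; last first.
  have -> : [set n | s n = a] = [set` [fset n in K]%fset].
    apply/seteqP; split=> n /=; rewrite !inE ?memK => /eqP//.
  by apply/card_eq_fsetP; rewrite card_fseq undup_id.
have sK i : s (nth 0%N K i) = a \/ (size K <= i)%N.
  have [iK|] := ltnP i (size K); last by right.
  by left; apply/eqP; rewrite -memK mem_nth.
exists (fun i : 'I_(size K) => f (nth 0%N K i)); split=> [c c0 k|].
  have := congr1 (fun x => '[x, f (nth 0%N K k)]) c0.
  rewrite /= dot0l dot_suml (bigD1 k)//= big1 => [|i ik].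
    rewrite addr0 dotZl nsqE f1 ?mulr1//.
    by case: (sK k) => [->//|]; rewrite leqNgt ltn_ord.
  rewrite dotZl fo' ?mulr0//.
  by apply: contra_neq ik => /eqP; rewrite nth_uniq// => /eqP/val_inj.
apply/seteqP; split=> x; rewrite /eigenspace_op /=; last first.
  move=> /linear_span_ord[c ->]; rewrite linear_sum scaler_sumr.
  apply: eq_bigr => i _; rewrite (linearZ_LR T) /= Tf.
  case: (sK i) => [->|]; last by rewrite leqNgt ltn_ord.
  by rewrite !scalerA mulrC.
move=> Tx; pose L := map f K.
have onL : ons dot L by apply: ons_map.
have TL g : g \in L -> T g = a%:C *: g.
  by move=> /mapP[n]; rewrite memK => /eqP sn ->; rewrite Tf sn.
have xE : x = proj dot L x.
  apply/eqP; rewrite -subr_eq0; apply/eqP; apply: (f_complete a _ a0).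
    rewrite (linearB T) /= Tx scalerBr; congr (_ - _).
    rewrite /proj linear_sum scaler_sumr; apply: eq_big_seq => g gL.
    by rewrite (linearZ_LR T) /= TL// !scalerA mulrC.
  (* If s n = a, then f n is in [L]; otherwise it belongs to another eigenvalue and is orthogonal to
     x. *)
  move=> n; have [sna|sna] := eqVneq (s n) a.
    by apply: dot_subproj => //; apply/map_f; rewrite memK; apply/eqP.
  have -> : '[x - proj dot L x, f n] = '[x, f n].
    rewrite dotBl /proj dot_suml big_seq big1 ?subr0// => _ /mapP[k kK ->].
    rewrite dotZl fo' ?mulr0//; apply: contraNneq sna => <-.
    by rewrite -memK.
  have := Tsym n x; rewrite Tx dotZl => /eqP.
  rewrite -subr_eq0 -mulrBl mulf_eq0 -rmorphB /= => /orP[|/eqP//].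
  by rewrite eq_complex /= eqxx andbT subr_eq0 eq_sym (negbTE sna).
exists (enum 'I_(size K)), (fun i => '[x, f (nth 0%N K i)]).
rewrite {1}xE /proj big_map big_enum /= (big_nth 0%N) big_mkord.
by [].
Qed.

End SingularSequences.

(** * Range and kernel projections *)

Section Basis.
Context {R : realType} {H : completeNormedModType R[i]}.
Variable dot : {dot H for conjC}.
Implicit Types (x y f g : H) (L : seq H).
Local Notation "''[' x , y ]" := (dot x y) : ring_scope.
Local Notation nsq := (nsq dot).
Local Notation ons := (ons dot).
Hypothesis dot_norm : induces_norm dot.

Lemma ler_sum_sub (J : eqType) (F G : seq J) (v : J -> R) :
  (forall i, 0 <= v i) -> uniq F -> uniq G -> {subset F <= G} ->
  \sum_(i <- F) v i <= \sum_(i <- G) v i.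
Proof.
move=> v0 uF uG FG; rewrite [leRHS](bigID (mem F)) /= -[leLHS]addr0.
rewrite lerD ?sumr_ge0// -[leRHS]big_filter.
have p : perm_eq F [seq i <- G | i \in F].
  apply: uniq_perm => [||i]; rewrite ?filter_uniq//.
  by rewrite mem_filter andb_idr// => /FG.
by rewrite (perm_big _ p) lexx.
Qed.

Lemma sum_seq1 (J : Type) (s : seq J) : \sum_(i <- s) 1 = (size s)%:R :> R.
Proof. by rewrite big_const_seq count_predT iter_addr_0. Qed.

Lemma csqB_le (a b : R[i]) : csq (a - b) <= csq a *+ 2 + csq b *+ 2.
Proof.
case: a b => [a b] [c d]; rewrite /csq /=.
have := sqr_ge0 (a + c); have := sqr_ge0 (b + d); nra.
Qed.

Lemma closure_nsq (V : set H) x : (forall e : R, 0 < e ->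
  exists2 y, V y & nsq (x - y) < e) -> closure V x.
Proof.
move=> h B /(nsq_nbhs dot_norm)[e e0 eB].
by have [y Vy xy] := h e e0; exists y; split=> //; exact: eB.
Qed.

Lemma nsq_closure (V : set H) x : closure V x -> forall e : R, 0 < e ->
  exists2 y, V y & nsq (x - y) < e.
Proof.
by move=> Vx e e0; have [y [Vy xy]] := Vx _ (nbhs_nsq dot_norm x e0); exists y.
Qed.

Lemma dot_closure0 (V : set H) w z : (forall v, V v -> '[w, v] = 0) ->
  closure V z -> '[w, z] = 0.
Proof.
move=> wV Vz; apply: csq_eq0; apply/eqP; rewrite eq_le csq_ge0 andbT.
apply: (@le0_eps _ _ (nsq w)) => e e0.
have [v Vv zv] := nsq_closure Vz e0.
have -> : '[w, z] = '[w, z - v] by rewrite dotBr (wV v)// subr0.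
by apply: le_trans (cauchy_schwarz _ _ _) _; rewrite ler_wpM2l ?nsq_ge0// ltW.
Qed.

(** The difference of two admissible values is orthogonal to [V], which contains both, hence to
    itself; so the choice in [orth_proj] is unique. *)
Lemma orth_proj_eq (V : set H) x y : V y -> (forall z, V z -> '[x - y, z] = 0) ->
  orth_proj dot V x = y.
Proof.
move=> Vy xyV; have : exists y', V y' /\ forall z, V z -> '[x - y', z] = 0.
  by exists y.
move=> /(xgetPex 0); rewrite -/(orth_proj dot V x).
set y' := orth_proj _ _ _ => -[Vy' xyV'].
apply/eqP; rewrite -subr_eq0; apply/eqP/(@nsq_eq0 _ _ dot).
have yy' z : V z -> '[y' - y, z] = 0.
  move=> Vz; have -> : y' - y = (x - y) - (x - y').
    by rewrite opprB [RHS]addrC subrKA.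
  by rewrite dotBl xyV// xyV'// subr0.
by rewrite /nsq dotBr !yy'// subr0.
Qed.

Lemma complete_nsq (u : nat -> H) :
  (forall e : R, 0 < e -> exists N, forall m n, (N <= m)%N -> (N <= n)%N ->
    nsq (u m - u n) < e) ->
  exists l, forall e : R, 0 < e -> exists N, forall n, (N <= n)%N ->
    nsq (u n - l) < e.
Proof.
move=> uc; have : cvg (u @ \oo).
  apply: cauchy_cvg; apply: cauchy_exP => -[a b] ab0.
  have a0 : 0 < a by move: ab0; rewrite ltcE /= => /andP[].
  have b0 : b = 0 by move: ab0; rewrite ltcE /= => /andP[/eqP].
  have [|N uN] := uc (a ^+ 2); first by rewrite exprn_gt0.
  exists (u N), N => // n Nn; rewrite -ball_normE /= b0 complexr0.
  by rewrite (normr_lt dot_norm)// uN.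
move=> ul; exists (lim (u @ \oo)) => e e0.
have [N _ uN] := ul _ (nbhs_nsq dot_norm _ e0).
by exists N => n Nn; rewrite nsqBC; exact: uN.
Qed.

(** Gram-Schmidt inside ker T, stopped at t vectors. This compares dim ker T with t even if the
    dimension is infinite. *)
Lemma kernel_dichotomy (T : {linear H -> H}) (t : nat) :
  (exists L, [/\ size L = t, ons L & forall h, h \in L -> T h = 0 /\ nsq h = 1]) \/
  (exists L, [/\ (size L < t)%N, ons L, forall h, h \in L -> T h = 0 &
    forall x, T x = 0 -> x = proj dot L x]).
Proof.
elim: t => [|t [[L [sL oL TL]]|[L [sL oL TL cL]]]].
- by left; exists [::].
- have [cL|/existsNP[x /not_implyP[Tx /eqP xL]]] :=
      pselect (forall x, T x = 0 -> x = proj dot L x).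
    by right; exists L; split=> //; [rewrite sL|move=> h /TL[]].
  have [|a a0 an] := @normalize _ _ dot (x - proj dot L x).
    by rewrite subr_eq0.
  left; exists (a%:C *: (x - proj dot L x) :: L); split.
  + by rewrite /= sL.
  + rewrite ons_cons oL an eqxx orbT andbT /=; apply/allP => f fL.
    by apply/eqP/dot_eq0C; rewrite dotZl dot_subproj// mulr0.
  + move=> h; rewrite inE => /predU1P[->|/TL//]; split=> //.
    rewrite (linearZ_LR T) (linearB T) /= Tx /proj linear_sum big_seq.
    rewrite big1 ?subr0 ?scaler0// => f /TL[Tf _].
    by rewrite (linearZ_LR T) /= Tf scaler0.
- by right; exists L; split=> //; exact: ltnW.
Qed.

Section CompactRange.
Variable T : {linear H -> H}.
Hypotheses (Tc : compact_op T) (Tpos : positive_op dot T).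
Local Notation q := (qf dot T).
Variable f : nat -> H.
Hypotheses (eigf : forall n, eigenvector dot T (f n))
  (f1 : forall n, f n = 0 \/ nsq (f n) = 1)
  (fo : forall i j, (i < j)%N -> '[f j, f i] = 0)
  (fmax : forall n y, (forall i, (i < n)%N -> '[y, f i] = 0) ->
        q y <= q (f n) * nsq y).

(** First q x <= q (f n) |x|^2 for all n forces q x = 0. Then [defect_le] with empty list reads |Mx
    - Tx|^2 <= M^2 |x|^2, where the left side is M^2 |x|^2 + |Tx|^2. *)
Lemma ker_orthogonal_spectral x : (forall n, '[x, f n] = 0) -> T x = 0.
Proof.
move=> xf; have qx0 : q x = 0.
  apply/eqP; rewrite eq_le qf_ge0// andbT; apply: (@le0_eps _ _ (nsq x)) => d d0.
  have [n _ qn] := orthogonal_eigenvalues_small dot_norm Tc Tpos eigf f1 fo d0 0.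
  apply: (le_trans (@fmax n x (fun i _ => xf i))).
  by rewrite mulrC ler_wpM2l ?nsq_ge0// ltW.
(* The summand 1 keeps M positive when T = 0. *)
pose M := q (f 0%N) + 1; have M0 : 0 < M by rewrite ltr_wpDl// qf_ge0.
have qM y : (forall g, g \in [::] -> '[y, g] = 0) -> q y <= M * nsq y.
  move=> _; have := @fmax 0%N y; rewrite mulrDl mul1r => /(_ (fun i => ltac:(by []))).
  by have := nsq_ge0 dot y; lra.
have := @defect_le _ _ dot T Tpos [::] M x M0 _ qM _.
rewrite qx0 subr0 nsqB nsqZ csq_real dotZl ReM_real.
have -> : complex.Re '[x, T x] = 0.
  by rewrite dotC ReC; exact: qx0.
move=> h; apply: (@nsq_eq0 _ _ dot); apply/eqP; rewrite eq_le nsq_ge0 andbT.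
have := h (fun _ => ltac:(by [])) (fun _ => ltac:(by [])).
by rewrite mulrA -expr2; lra.
Qed.

Lemma mkseq_ons n : ons (mkseq f n).
Proof. by apply: ons_map => //; [exact: lt_orthogonal|exact: iota_uniq]. Qed.

(** The partial sums u n are Cauchy since their Bessel sums b n increase to a finite supremum. The
    remainder r is orthogonal to all f i, so it lies in ker T and is orthogonal to y - u n; as y - u
    n tends to r, this gives r = 0. *)
Lemma spectral_expansion y : (forall z, T z = 0 -> '[y, z] = 0) ->
  forall e : R, 0 < e -> exists n, nsq (y - proj dot (mkseq f n) y) < e.
Proof.
move=> yker; pose u n := proj dot (mkseq f n) y.
pose b n : R := \sum_(g <- mkseq f n) csq '[y, g].
have uD m n : (m <= n)%N -> b n - b m = nsq (u n - u m).
  move=> mn; have mE : mkseq f n = mkseq f m ++ map f (iota m (n - m)).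
    by rewrite /mkseq -map_cat -{1}(add0n m) -iotaD subnKC.
  rewrite /b /u mE /proj !big_cat /= addrAC subrr add0r [X in nsq X]addrAC subrr add0r.
  rewrite -/(proj dot _ y) nsq_proj//.
  by apply: ons_map => //; [exact: lt_orthogonal|exact: iota_uniq].
have b_bound n : b n <= nsq y by apply: bessel; exact: mkseq_ons.
have supb : has_sup (range b).
  by split; [exists (b 0%N), 0%N|exists (nsq y) => _ [n _ <-]].
have bS n : b n <= sup (range b).
  by apply: ub_le_sup; [case: supb|exists n].
have [l ul] : exists l, forall e : R, 0 < e -> exists N, forall n, (N <= n)%N ->
    nsq (u n - l) < e.
  apply: complete_nsq => e e0.
  have [_ [N _ <-] bN] := sup_adherent e0 supb.
  have bN' n : (N <= n)%N -> b N <= b n.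
    by move=> /uD h; rewrite -subr_ge0 h nsq_ge0.
  exists N; suff h m n : (N <= m)%N -> (m <= n)%N -> nsq (u n - u m) < e.
    move=> m n Nm Nn; have [mn|/ltnW nm] := leqP m n; last exact: h.
    by rewrite nsqBC h.
  move=> Nm mn; rewrite -uD//; have := bN' m Nm; have := bS n; lra.
pose r := y - l.
have ur (e : R) : 0 < e -> exists N, forall n, (N <= n)%N ->
    nsq ((y - u n) - r) < e.
  move=> /ul[N uN]; exists N => n /uN.
  by rewrite nsqBC /r opprB [y - u n + _]addrC subrKA.
have rf i : '[r, f i] = 0.
  apply: csq_eq0; apply/eqP; rewrite eq_le csq_ge0 andbT.
  apply: (@le0_eps _ _ (nsq (f i))) => e /ur[N uN].
  have fi : f i \in mkseq f (maxn N i.+1).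
    by apply: map_f; rewrite mem_iota add0n leq_max leqnn orbT.
  have := dot_subproj y (mkseq_ons _) fi; rewrite -/(u _) => yu.
  have -> : '[r, f i] = - '[(y - u (maxn N i.+1)) - r, f i].
    by rewrite dotBl yu sub0r opprK.
  rewrite -mulN1r csqM; have -> : csq (-1 : R[i]) = 1.
    by rewrite /csq /= oppr0 sqrrN expr1n expr0n addr0.
  rewrite mul1r; apply: le_trans (cauchy_schwarz _ _ _) _.
  by rewrite mulrC ler_wpM2l ?nsq_ge0// ltW// uN// leq_maxl.
have Tr := ker_orthogonal_spectral rf.
have yur n : '[y - u n, r] = 0.
  rewrite dotBl yker// sub0r dot_suml big_seq big1 ?oppr0// => g.
  by move=> /mapP[k _ ->]; rewrite dotZl (dot_eq0C (rf k)) mulr0.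
have r0 : r = 0.
  apply: (@nsq_eq0 _ _ dot); apply/eqP; rewrite eq_le nsq_ge0 andbT.
  apply: (@le0_eps _ _ 1) => e /ur[N uN]; rewrite mul1r.
  have := uN N (leqnn N); rewrite nsqB yur /= mul0rn subr0.
  by have := nsq_ge0 dot (y - u N); lra.
by move=> e /ur[N uN]; exists N; have := uN N (leqnn N); rewrite r0 subr0.
Qed.

Lemma closure_range_of_ker y : (forall z, T z = 0 -> '[y, z] = 0) ->
  closure (range T) y.
Proof.
move=> yker; apply: closure_nsq => e e0.
have [n yn] := spectral_expansion yker e0.
exists (proj dot (mkseq f n) y) => //.
(* The coefficients are divided by the eigenvalues. If q g = 0, then g is in ker T and its
   coefficient <y, g> is 0 anyway. *)
exists (\sum_(g <- mkseq f n) ((q g)^-1%:C * '[y, g]) *: g) => //.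
rewrite linear_sum; apply: eq_big_seq => g /mapP[k _ ->].
rewrite (linearZ_LR T) /= eigf scalerA mulrAC -rmorphM /=.
have [qk0|qk] := eqVneq (q (f k)) 0; last by rewrite mulVf ?mul1r.
by rewrite yker ?mulr0// eigf qk0 scale0r.
Qed.

(** x - proj L x is orthogonal to ker T, so it lies in the closure of the range; proj L x is a
    combination of kernel vectors, so it is orthogonal to the range. *)
Lemma range_proj_perp_ker L : ons L -> (forall h, h \in L -> T h = 0) ->
  (forall x, T x = 0 -> x = proj dot L x) ->
  forall x, range_proj_perp dot T x = proj dot L x.
Proof.
move=> oL TL cL x; rewrite /range_proj_perp /range_proj.
rewrite (@orth_proj_eq _ _ (x - proj dot L x)) ?subKr//.
  apply: closure_range_of_ker => z /cL ->; rewrite dotC dot_suml.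
  rewrite big_seq big1 ?rmorph0// => h hL.
  by rewrite dotZl (dot_eq0C (dot_subproj _ oL hL)) mulr0.
move=> z; apply: dot_closure0 => _ [w _ <-].
rewrite dot_suml big_seq big1// => h hL.
by rewrite dotZl -(positive_selfadjoint Tpos) TL// dot0l mulr0.
Qed.

End CompactRange.
End Basis.

(** * Schur's theorem and its refinement *)

Lemma seq_max (R : realType) (J : eqType) (d : J -> R) (s : seq J) i :
  i \in s -> exists2 j, j \in s & forall k, k \in s -> d k <= d j.
Proof.
elim: s i => // i0 s IHs i _; case: s IHs => [_|i1 s IHs].
  by exists i0; rewrite ?mem_head// => k; rewrite inE => /eqP ->.
have [j js jmax] := IHs i1 (mem_head _ _).
have [ij|ji] := leP (d i0) (d j).
  exists j; first by rewrite inE js orbT.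
  by move=> k; rewrite inE => /predU1P[->|/jmax].
exists i0; first exact: mem_head.
move=> k; rewrite inE => /predU1P[->//|/jmax kj].
exact/ltW/(le_lt_trans kj).
Qed.

Lemma nneseries_le_approx (R : realType) (u v : R^nat) :
  (forall n, 0 <= u n) -> (forall n, 0 <= v n) ->
  (forall n (e : R), 0 < e ->
    exists m, \sum_(j < n) u j <= \sum_(j < m) v j + e) ->
  (\sum_(0 <= j <oo) (u j)%:E <= \sum_(0 <= j <oo) (v j)%:E)%E.
Proof.
move=> u0 v0 uv; apply: lime_le.
  by apply: is_cvg_nneseries => n _ _; rewrite lee_fin.
near=> n; apply/lee_addgt0Pr => e e0; have [m nm] := uv n e e0.
rewrite sumEFin big_mkord; apply: (@le_trans _ _ (\sum_(j < m) v j + e)%:E).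
  by rewrite lee_fin.
rewrite EFinD leeD2r// -(big_mkord xpredT v) -sumEFin.
by apply: nneseries_lim_ge => k _ _; rewrite lee_fin.
Unshelve. all: by end_near. Qed.

Section Main.
Context {R : realType} {H : completeNormedModType R[i]}.
Variable dot : {dot H for conjC}.
Implicit Types (x y h : H) (L : seq H).
Local Notation "''[' x , y ]" := (dot x y) : ring_scope.
Local Notation nsq := (nsq dot).
Local Notation ons := (ons dot).
Hypothesis dot_norm : induces_norm dot.
Variable T : {linear H -> H}.
Hypotheses (Tc : compact_op T) (Tpos : positive_op dot T).
Local Notation q := (qf dot T).
Variable f : nat -> H.
Hypotheses (eigf : forall n, eigenvector dot T (f n))
  (f1 : forall n, f n = 0 \/ nsq (f n) = 1)
  (f0 : forall n, q (f n) = 0 -> f n = 0)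
  (fo : forall i j, (i < j)%N -> '[f j, f i] = 0)
  (fmax : forall n y, (forall i, (i < n)%N -> '[y, f i] = 0) ->
        q y <= q (f n) * nsq y).

Lemma f_nsq_le1 n : nsq (f n) <= 1.
Proof. by case: (f1 n) => ->//; rewrite nsq0. Qed.

Lemma eigenvalues_nonincreasing : nonincreasing_seq (fun n => q (f n)).
Proof.
move=> m n mn; apply: le_trans (@fmax m (f n) _) _.
  by move=> i im; apply: fo; exact: leq_trans im mn.
by apply: ler_piMr; [exact: qf_ge0|exact: f_nsq_le1].
Qed.

Lemma eigenvalues_small (a : R) : 0 < a -> exists n, q (f n) < a.
Proof.
move=> a0.
have [n _ na] := orthogonal_eigenvalues_small dot_norm Tc Tpos eigf f1 fo a0 0.
by exists n.
Qed.

Lemma is_sing_seq_compact_positive : is_sing_seq T (fun n => q (f n)).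
Proof.
apply: (@is_sing_seq_eigenvectors _ _ dot T f) => //.
- exact: eigenvalues_nonincreasing.
- by move=> n; exact: qf_ge0.
- exact: eigenvalues_small.
- by move=> n x; rewrite (positive_selfadjoint Tpos) eigf dotZr conj_realC.
- by move=> n qn; case: (f1 n) => // fn0; rewrite fn0 qf0 ltxx in qn.
- move=> a x a0 Tx xf.
  have := ker_orthogonal_spectral dot_norm Tc Tpos eigf f1 fo fmax xf.
  rewrite Tx => /eqP; rewrite scaler_eq0 => /orP[|/eqP//].
  by rewrite eq_complex /= eqxx andbT gt_eqF.
Qed.

(** If q (f n) = 0, then f n is the padding vector 0. Hence kernel vectors can be appended to the f
    j in one orthonormal system. *)
Lemma ker_spectral_orthogonal h n : T h = 0 -> '[h, f n] = 0.
Proof.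
move=> Th; have := positive_selfadjoint Tpos h (f n).
rewrite Th dot0l eigf dotZr conj_realC => /esym/eqP.
rewrite mulf_eq0 => /orP[|/eqP//]; rewrite eq_complex /= eqxx andbT => /eqP qn.
by rewrite (f0 qn) dot0r.
Qed.

Lemma qf_kernel h : T h = 0 -> q h = 0.
Proof. by move=> Th; rewrite /qf Th dot0l. Qed.

Lemma sum_csq_spectral_le n x : \sum_(j < n) q (f j) * csq '[x, f j] <= q x.
Proof.
rewrite (@qf_subproj _ _ dot T Tpos (mkseq f n) x).
- by rewrite sum_mkseqE lerDl qf_ge0.
- exact: mkseq_ons.
- by move=> g /mapP[k _ ->]; exact: eigf.
Qed.

(* Ky Fan's inequality when L is empty and n = size G. *)
Lemma sum_qf_le (G L : seq H) n : ons G -> ons L ->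
  (forall h, h \in L -> T h = 0) ->
  \sum_(g <- G) q g <= \sum_(j < n) q (f j) +
    q (f n) * ((size G)%:R - n%:R - \sum_(g <- G) \sum_(h <- L) csq '[g, h]).
Proof.
move=> oG oL TL.
have oFL : ons (mkseq f n ++ L).
  rewrite ons_cat oL mkseq_ons//=; apply/allrelP => _ h /mapP[k _ ->] hL.
  by rewrite ker_spectral_orthogonal// TL.
have G1 g : g \in G -> nsq g <= 1.
  move: oG => /andP[/allP G1 _] /G1/orP[/eqP->|/eqP->//].
  by rewrite nsq0.
have s_dec := eigenvalues_nonincreasing.
(* Terms are regrouped so that |<g, f j>|^2 carries the nonnegative weight q (f j) - q (f n). *)
have one g : g \in G -> q g <= \sum_(j < n) (q (f j) - q (f n)) * csq '[g, f j]
    + q (f n) * (1 - \sum_(h <- L) csq '[g, h]).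
  move=> gG; apply: le_trans (@qf_le_proj _ _ dot T Tpos _ (q (f n)) g oFL _ _) _.
  - by move=> h; rewrite mem_cat => /orP[/mapP[k _ ->]|/TL Th];
      [exact: eigf|rewrite Th qf_kernel// scale0r].
  - move=> y yL; apply: fmax => i ilt; apply: yL.
    by rewrite mem_cat map_f// mem_iota.
  - have L0 : \sum_(h <- L) q h * csq '[g, h] = 0.
      by rewrite big_seq big1// => h /TL Th; rewrite (qf_kernel Th) mul0r.
    rewrite !big_cat /= L0.
    rewrite !sum_mkseqE addr0.
    under [in leRHS]eq_bigr do rewrite mulrBl.
    rewrite sumrB -mulr_sumr.
    have := G1 g gG; move: (nsq g) => N1 h1.
    have := ler_wpM2l (qf_ge0 Tpos (f n)) h1; lra.
rewrite big_seq; apply: le_trans (ler_sum _ one) _; rewrite -big_seq.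
rewrite big_split /= -mulr_sumr sumrB exchange_big /=.
rewrite sum_seq1.
(* Bessel's inequality for f j in the system [G]. *)
have : \sum_(j < n) \sum_(g <- G) (q (f j) - q (f n)) * csq '[g, f j] <=
    \sum_(j < n) (q (f j) - q (f n)).
  apply: ler_sum => j _; rewrite -mulr_sumr ler_piMr//.
    by rewrite subr_ge0 s_dec// ltnW.
  apply: le_trans (f_nsq_le1 j); apply: le_trans (bessel (f j) oG).
  by apply: ler_sum => g _; rewrite dotC csqC.
rewrite sumrB sumr_const card_ord -[_ *+ n]mulr_natr; lra.
Qed.

(** With q (f n) < a / 2, Ky Fan's inequality gives |G| a <= S + |G| a / 2. *)
Lemma few_large_values (a : R) : 0 < a -> exists N, forall G, ons G ->
  (forall g, g \in G -> a <= q g) -> (size G <= N)%N.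
Proof.
move=> a0; have [n sn] := eigenvalues_small (divr_gt0 a0 (ltr0n R 2)).
set S := \sum_(j < n) q (f j); exists (Num.truncn (S / (a / 2))) => G oG Ga.
have Gle : (size G)%:R * a <= \sum_(g <- G) q g.
  have -> : (size G)%:R * a = \sum_(g <- G) a.
    by rewrite big_const_seq count_predT iter_addr_0 mulr_natl.
  by rewrite big_seq [leRHS]big_seq; exact: ler_sum.
have := sum_qf_le n oG (erefl : ons [::]) (fun h => ltac:(by [])).
rewrite [X in _ - X]big1 ?subr0 => [GS|g _]; last by rewrite big_nil.
rewrite truncn_ge_nat; last first.
  by rewrite divr_ge0 ?sumr_ge0 ?divr_ge0 ?(ltW a0)// => j _; exact: qf_ge0.
rewrite ler_pdivlMr ?divr_gt0//.
have sn0 := qf_ge0 Tpos (f n).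
have h1 : q (f n) * (size G)%:R <= a / 2 * (size G)%:R by rewrite ler_wpM2r// ltW.
have h2 : 0 <= q (f n) * n%:R by rewrite mulr_ge0.
move: GS; rewrite -/S mulrBr; lra.
Qed.

Section Diagonal.
(** In the application [V] is the adjoint of the unitary and [B] the conditional expectation, whose
    diagonal entries are the [d i]. By [V_parseval], the vectors V (e i) still form a basis. *)
Variables (I : countType) (e : I -> H) (V : H -> H) (B : {linear H -> H}).
Hypotheses (e_on : forall i j, '[e i, e j] = (i == j)%:R)
  (e_parseval : forall x (a : R), 0 < a -> exists2 F : seq I, uniq F &
    nsq x - a <= \sum_(i <- F) csq '[x, e i])
  (V_iso : forall x y, '[V x, V y] = '[x, y])
  (V_parseval : forall x (a : R), 0 < a -> exists2 F : seq I, uniq F &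
    nsq x - a <= \sum_(i <- F) csq '[x, V (e i)])
  (Be : forall i, B (e i) = (q (V (e i)))%:C *: e i)
  (B_dot : forall i x, '[B x, e i] = (q (V (e i)))%:C * '[x, e i]).
Local Notation d i := (q (V (e i))).
Local Notation qB := (qf dot B).

Lemma orthonormal_nsq i : nsq (e i) = 1.
Proof. by rewrite /nsq e_on eqxx. Qed.

Lemma orthonormal_dot0 i j : i != j -> '[e i, e j] = 0.
Proof. by rewrite e_on => /negbTE ->. Qed.

Lemma V_nsq x : nsq (V x) = nsq x.
Proof. by rewrite /nsq V_iso. Qed.

Lemma V0 : V 0 = 0.
Proof. by apply: (@nsq_eq0 _ _ dot); rewrite V_nsq nsq0. Qed.

Lemma qB_e i : qB (e i) = d i.
Proof. by rewrite (qf_eig dot (Be i)) orthonormal_nsq mulr1. Qed.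

Lemma V_ons (J : eqType) (g : J -> H) (K : seq J) :
  (forall i, g i = 0 \/ nsq (g i) = 1) ->
  (forall i j, i != j -> '[g i, g j] = 0) -> uniq K -> ons (map (V \o g) K).
Proof.
move=> g1 go; apply: ons_map => [i|i j ij]; last by rewrite V_iso go.
by rewrite /= V_nsq; case: (g1 i) => ->; [left; exact: V0|right].
Qed.

Lemma large_diagonal_finite (a : R) : 0 < a -> finite_set [set i | a <= d i].
Proof.
move=> a0; have [N hN] := few_large_values a0.
apply: contrapT => /infinite_set_fsetP/(_ N.+1)[F Fa]; rewrite ltnNge.
apply/negP; rewrite negbK; have <- : size (map (V \o e) F) = #|` F|%fset.
  by rewrite size_map.
apply: hN => [|_ /mapP[i iF ->]]; last exact: Fa.
apply: V_ons; [by move=> i; right; exact: orthonormal_nsq|exact: orthonormal_dot0|].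
exact: fset_uniq.
Qed.

(** [g] lists the basis vectors with positive diagonal entry in decreasing order of that entry, then
    zeros. A maximum exists because only finitely many entries are at least a given positive one. *)
Lemma diagonal_greedy : exists g : nat -> H,
  [/\ forall n, g n = 0 \/ exists2 i, g n = e i & 0 < d i,
      forall m n, m != n -> '[g m, g n] = 0 &
      forall n i, (forall k, (k < n)%N -> '[e i, g k] = 0) -> d i <= qB (g n)].
Proof.
have [||L _ [x [[[i _ <-] iL]]]|g gP] :=
  @greedy_sequence _ _ dot (range e) setT qB => //.
- exact: qf0.
- rewrite qB_e => di.
  have /finite_seqP[s sE] := large_diagonal_finite di.
  pose s' := [seq j <- s | all (fun y => '[e j, y] == 0) L].
  have cand j : j \in s' -> candidate dot (range e) L (e j).
    rewrite mem_filter => /andP[/allP jL _]; split=> // y yL.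
    exact/eqP/jL.
  have is' : i \in s'.
    rewrite mem_filter; apply/andP; split.
      by apply/allP => y yL; apply/eqP/iL.
    have : [set j | d i <= d j] i := lexx _.
    by rewrite sE.
  have [j js jmax] := seq_max (fun j => d j) is'.
  have ij := jmax i is'.
  exists (e j); split=> //.
  + exact: cand.
  + by rewrite qB_e; exact: lt_le_trans ij.
  + move=> _ [[k _ <-] kL]; rewrite !qB_e.
    have [ki|ik] := leP (d k) (d i); first exact: le_trans ij.
    apply: jmax; rewrite mem_filter; apply/andP; split.
      by apply/allP => y yL; apply/eqP/kL.
    have : [set j | d i <= d j] k := ltW ik.
    by rewrite sE.
- exists g; split=> [n|m n|n i ig].
  + have [_ [->|[[i _ gi] qi]] _ _] := gP n; first by left.
    by right; exists i; rewrite // -qB_e gi.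
  + by apply: lt_orthogonal => i j ij; have [_ _ + _] := gP j; apply.
  + by have [_ _ _] := gP n; rewrite -qB_e; apply=> //; exists i.
Qed.

Variable g : nat -> H.
Hypotheses (gE : forall n, g n = 0 \/ exists2 i, g n = e i & 0 < d i)
  (go : forall m n, m != n -> '[g m, g n] = 0)
  (gmax : forall n i, (forall k, (k < n)%N -> '[e i, g k] = 0) ->
    d i <= qB (g n)).

Lemma g_nsq n : g n = 0 \/ nsq (g n) = 1.
Proof. by case: (gE n) => [|[i -> _]]; [left|right; exact: orthonormal_nsq]. Qed.

Lemma qB_g n : qB (g n) = q (V (g n)).
Proof. by case: (gE n) => [->|[i -> _]]; rewrite ?qB_e// V0 !qf0. Qed.

Lemma qB_g_ge0 n : 0 <= qB (g n).
Proof. by rewrite qB_g qf_ge0. Qed.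

Lemma diagonal_nonincreasing : nonincreasing_seq (fun n => qB (g n)).
Proof.
move=> m n mn; case: (gE n) => [->|[i gn _]]; first by rewrite qf0 qB_g_ge0.
rewrite gn qB_e; apply: gmax => k km; rewrite -gn go//.
by rewrite gtn_eqF// (leq_trans km).
Qed.

Lemma diagonal_small (a : R) : 0 < a -> exists n, qB (g n) < a.
Proof.
move=> a0; have [N hN] := few_large_values a0.
apply: contrapT => nn.
have oG : ons (map (V \o g) (iota 0 N.+1)).
  by apply: V_ons; [exact: g_nsq|exact: go|exact: iota_uniq].
have := hN _ oG; rewrite size_map size_iota ltnn => h; suff : false by []; apply: h.
move=> _ /mapP[n _ ->]; rewrite /= -qB_g leNgt; apply/negP => na.
by apply: nn; exists n.
Qed.

(** An [e i] never chosen would stay a candidate forever, so d i <= qB (g n) for all n, while these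
    values tend to 0. *)
Lemma diagonal_exhausted i : 0 < d i -> exists n, g n = e i.
Proof.
move=> di; apply: contrapT => ni; have [n] := diagonal_small di.
rewrite ltNge gmax// => k _; case: (gE k) => [->|[j gk _]].
  exact: dot0r.
rewrite gk orthonormal_dot0//; apply/eqP => ij; apply: ni.
by exists k; rewrite gk ij.
Qed.

Lemma is_sing_seq_diagonal : is_sing_seq B (fun n => qB (g n)).
Proof.
apply: (@is_sing_seq_eigenvectors _ _ dot B g).
- exact: diagonal_nonincreasing.
- exact: qB_g_ge0.
- exact: diagonal_small.
- by move=> n; case: (gE n) => [->|[i -> _]];
    [rewrite linear0 scaler0|rewrite Be qB_e].
- by move=> n x; case: (gE n) => [->|[i -> _]];
    [rewrite !dot0r mulr0|rewrite B_dot qB_e].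
- by move=> n gn; case: (g_nsq n) => // gn0; rewrite gn0 qf0 ltxx in gn.
- exact: g_nsq.
- by move=> i j ij; apply: go; rewrite gtn_eqF.
- move=> a x a0 Bx xg.
  (* A nonzero coefficient would force d i = a > 0, so that [e i] is some g n, to which x is
     orthogonal. *)
  have xe i : '[x, e i] = 0.
    have := B_dot i x; rewrite Bx dotZl => /eqP.
    rewrite -subr_eq0 -mulrBl mulf_eq0 -rmorphB /= => /orP[|/eqP//].
    rewrite eq_complex /= eqxx andbT subr_eq0 => /eqP ad.
    have [|n <-] := @diagonal_exhausted i; first by rewrite -ad.
    exact: xg.
  apply: (@nsq_eq0 _ _ dot); apply/eqP; rewrite eq_le nsq_ge0 andbT.
  apply: (@le0_eps _ _ 1) => t t0; have [F _] := e_parseval x t0.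
  rewrite big1 => [|i _]; last by rewrite xe csq0.
  lra.
Qed.

(** Every [e i] with d i > 0 is some g n, and distinct i have distinct n. It is applied to the form
    of T and to the mass of kernel vectors. *)
Lemma diagonal_cover (F : seq I) (v : H -> R) : uniq F -> (forall x, 0 <= v x) ->
  exists m0, forall m, (m0 <= m)%N ->
    \sum_(i <- F | 0 < d i) v (e i) <= \sum_(k < m) v (g k).
Proof.
move=> uF v0; have /choice[k kP] : forall i, exists n, 0 < d i -> g n = e i.
  move=> i; have [di|di] := pselect (0 < d i); last by exists 0%N.
  by have [n gn] := diagonal_exhausted di; exists n.
pose K := [seq k i | i <- F & 0 < d i].
exists (\max_(n <- K) n).+1 => m Km.
have -> : \sum_(i <- F | 0 < d i) v (e i) = \sum_(n <- K) v (g n).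
  rewrite big_map big_filter; apply: eq_bigr => i di; by rewrite kP.
rewrite -(big_mkord xpredT (fun n => v (g n))).
apply: (@ler_sum_sub _ _ _ _ (fun n => v (g n))) => //.
- rewrite map_inj_in_uniq ?filter_uniq// => i j.
  rewrite !mem_filter => /andP[di _] /andP[dj _] kij.
  apply/eqP; have := e_on i j; rewrite -(kP i di) kij (kP j dj) e_on eqxx.
  by case: eqP => // _ /eqP; rewrite oner_eq0.
- exact: iota_uniq.
- move=> n nK; rewrite mem_index_iota /=; apply: leq_trans Km.
  by rewrite ltnS; exact: (@leq_bigmax_seq _ _ xpredT id).
Qed.

Lemma V_parseval_seq L (a : R) : 0 < a -> exists2 F : seq I, uniq F &
  forall x, x \in L -> nsq x - a <= \sum_(i <- F) csq '[x, V (e i)].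
Proof.
move=> a0; elim: L => [|x L [F uF FL]]; first by exists [::].
have [F' uF' Fx] := V_parseval x a0.
have sub (G : seq I) y : uniq G -> {subset G <= undup (F ++ F')} ->
    \sum_(i <- G) csq '[y, V (e i)] <= \sum_(i <- undup (F ++ F')) csq '[y, V (e i)].
  move=> uG sG; apply: (@ler_sum_sub _ _ _ _ (fun i => csq '[y, V (e i)])) => //.
  - by move=> i; exact: csq_ge0.
  - exact: undup_uniq.
exists (undup (F ++ F')); first exact: undup_uniq.
move=> y; rewrite inE => /predU1P[->|/FL yF].
  apply: le_trans Fx _; apply: sub => // i iF.
  by rewrite mem_undup mem_cat iF orbT.
apply: le_trans yF _; apply: sub => // i iF.
by rewrite mem_undup mem_cat iF.
Qed.

Lemma V_ons_g n : ons (mkseq (V \o g) n).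
Proof. by apply: V_ons; [exact: g_nsq|exact: go|exact: iota_uniq]. Qed.

Lemma sum_diagonal_le (L : seq H) m n : ons L -> (forall h, h \in L -> T h = 0) ->
  \sum_(j < m) qB (g j) <= \sum_(j < n) q (f j) +
    q (f n) * (m%:R - n%:R - \sum_(j < m) \sum_(h <- L) csq '[V (g j), h]).
Proof.
move=> oL TL; have := sum_qf_le n (V_ons_g m) oL TL.
rewrite size_mkseq !sum_mkseqE; apply: le_trans.
by apply: ler_sum => j _; rewrite qB_g.
Qed.

(** The partial sums are Ky Fan's inequality with empty [L]. For the totals, which may be infinite,
    a finite [F] is chosen on which f 0, ..., f (n-1) have almost all their mass; the entries d i
    over F then sum to almost the first n eigenvalues. *)
Lemma schur_majorized : majorized (fun n => qB (g n)) (fun n => q (f n)).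
Proof.
have le n : \sum_(j < n) qB (g j) <= \sum_(j < n) q (f j).
  have := sum_diagonal_le n n (erefl : ons [::]) (fun h => ltac:(by [])).
  by rewrite subrr [X in _ - X]big1 ?subr0 ?mulr0 ?addr0// => j _; rewrite big_nil.
split=> //; apply/eqP; rewrite eq_le; apply/andP; split; apply: nneseries_le_approx.
- exact: qB_g_ge0.
- by move=> n; exact: qf_ge0.
- by move=> n t t0; exists n; rewrite ler_wpDr// ltW.
- by move=> n; exact: qf_ge0.
- exact: qB_g_ge0.
- move=> n t t0; pose S := \sum_(j < n) q (f j).
  have S0 : 0 <= S by rewrite sumr_ge0// => j _; exact: qf_ge0.
  have S1 : 0 < S + 1 by rewrite ltr_wpDl.
  (* Weighted by the eigenvalues, the losses add up to S t / (S + 1) <= t; the 1 covers S = 0. *)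
  have [F uF FP] := V_parseval_seq (mkseq f n) (divr_gt0 t0 S1).
  have [m mP] := diagonal_cover uF (fun x => qf_ge0 Tpos (V x)); exists m.
  have dF : \sum_(i <- F) d i = \sum_(i <- F | 0 < d i) d i.
    rewrite [LHS](bigID (fun i => 0 < d i)) /= [X in _ + X]big1 ?addr0// => i.
    by rewrite -leNgt => di; apply/eqP; rewrite eq_le di qf_ge0.
  have := mP m (leqnn m); rewrite -dF.
  under [leRHS]eq_bigr do rewrite -qB_g.
  have csqS x y : csq '[x, y] = csq '[y, x] by rewrite dotC csqC.
  have : \sum_(i <- F) \sum_(j < n) q (f j) * csq '[V (e i), f j] <= \sum_(i <- F) d i.
    by apply: ler_sum => i _; exact: sum_csq_spectral_le.
  rewrite exchange_big /=; set X := \sum_(j < n) _ => XF Fm.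
  have tS : t / (S + 1) * S <= t.
    by rewrite mulrAC ler_pdivrMr// ler_wpM2l ?lerDl ?(ltW t0).
  suff SX : S <= X + t / (S + 1) * S.
    rewrite -/S; apply: le_trans SX (lerD _ tS).
    exact: le_trans Fm.
  rewrite /X mulr_sumr -big_split /=; apply: ler_sum => j _.
  rewrite -mulr_sumr [_ * q (f j)]mulrC -mulrDr.
  have [fj|fj] := f1 j; first by rewrite fj qf0 !mul0r.
  rewrite -[leLHS]mulr1 ler_wpM2l ?qf_ge0// -lerBlDr.
  under eq_bigr do rewrite csqS.
  by have := FP (f j); rewrite fj; apply; rewrite map_f// mem_iota /= add0n.
Qed.

(* The #|Z| + k kernel vectors have total mass #|Z| + k on the basis V e_i, and the
   indices i in Z can carry at most #|Z| of it. *)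
Lemma schur_approx_majorized (Z : seq I) (L : seq H) (k : nat) : uniq Z ->
  (forall i, d i = 0 -> i \in Z) -> ons L ->
  (forall h, h \in L -> T h = 0 /\ nsq h = 1) -> size L = (size Z + k)%N ->
  approx_majorized_fin k (fun n => qB (g n)) (fun n => q (f n)).
Proof.
move=> uZ ZP oL TL sL; split; first exact: schur_majorized.
move=> t t0; pose v x := \sum_(h <- L) csq '[V x, h].
have v0 x : 0 <= v x by rewrite sumr_ge0// => h _; exact: csq_ge0.
have L1 : 0 < (size L)%:R + 1 :> R by rewrite ltr_wpDl.
(* Each of the |L| kernel vectors loses at most t / (|L| + 1), in total at most t. *)
have [F uF FP] := V_parseval_seq L (divr_gt0 t0 L1).
have csqS x y : csq '[x, y] = csq '[y, x] by rewrite dotC csqC.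
have Fv : (size L)%:R - t <= \sum_(i <- F) v (e i).
  rewrite exchange_big /=.
  apply: (@le_trans _ _ (\sum_(h <- L) (1 - t / ((size L)%:R + 1)))).
    rewrite big_const_seq count_predT iter_addr_0 mulrnBl -[(t / _) *+ _]mulr_natr.
    by rewrite lerB// mulrAC ler_pdivrMr// ler_wpM2l ?lerDl ?(ltW t0).
  rewrite big_seq [leRHS]big_seq; apply: ler_sum => h hL.
  under eq_bigr do rewrite csqS.
  by have := FP h hL; rewrite (TL h hL).2.
have [m mP] := diagonal_cover uF v0.
exists m => n mn; have nk : (m <= n + k)%N by rewrite (leq_trans mn)// leq_addr.
(* With n + k vectors against n eigenvalues, it remains to see that the kernel mass X is at least k
   - t. *)
apply: le_trans (sum_diagonal_le (n + k) n oL (fun h hL => (TL h hL).1)) _.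
rewrite lerD2l mulrC ler_wpM2r ?qf_ge0//.
have := mP _ nk; set X := \sum_(j < n + k) _ => FX.
(* By Bessel's inequality in [L] each unit vector V (e i) carries mass at most 1. *)
have FZ : \sum_(i <- F | ~~ (0 < d i)) v (e i) <= (size Z)%:R.
  rewrite -sum_seq1 -big_filter; set F0 := [seq i <- F | _].
  apply: (@le_trans _ _ (\sum_(i <- F0) 1)).
    apply: ler_sum => i _; apply: le_trans (bessel (V (e i)) oL) _.
    by rewrite V_nsq orthonormal_nsq.
  apply: (@ler_sum_sub _ _ _ _ (fun=> 1)); rewrite ?filter_uniq// => i.
  rewrite mem_filter -leNgt => /andP[di _]; apply: ZP.
  by apply/eqP; rewrite eq_le di qf_ge0.
move: Fv; rewrite (bigID (fun i => 0 < d i)) /= sL !natrD.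
change (\sum_(j < n + k) \sum_(h <- L) csq '[V (g j), h]) with X.
lra.
Qed.

End Diagonal.
End Main.

(** * Traces and the main theorem *)

Section Traces.
Context {R : realType} {H : completeNormedModType R[i]}.
Variable dot : {dot H for conjC}.
Implicit Types (x y h : H) (L : seq H).
Local Notation "''[' x , y ]" := (dot x y) : ring_scope.
Local Notation nsq := (nsq dot).
Local Notation ons := (ons dot).
Hypothesis dot_norm : induces_norm dot.
Variables (I : countType) (e : I -> H).
Hypothesis e_basis : orthonormal_basis dot e.

Lemma basis_ons (F : seq I) : uniq F -> ons (map e F).
Proof.
apply: ons_map; last exact: (orthonormal_dot0 e_basis.1).
by move=> i; right; exact: (orthonormal_nsq e_basis.1).
Qed.

(** The projection onto the [e i] of an approximating combination is at least as close to x as that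
    combination. *)
Lemma basis_parseval x (a : R) : 0 < a ->
  exists2 F : seq I, uniq F & nsq x - a <= \sum_(i <- F) csq '[x, e i].
Proof.
move=> a0; have : closure (linear_span e) x by rewrite e_basis.2.
move=> /(nsq_closure dot_norm)/(_ _ a0)[_ [s [c ->]]].
set z := \sum_(i <- s) _ => xz; exists (undup s); first exact: undup_uniq.
have oF := basis_ons (undup_uniq s); set P := proj dot (map e (undup s)) x.
have xPe i : i \in s -> '[e i, x - P] = 0.
  move=> si; apply: dot_eq0C; apply: dot_subproj => //.
  by rewrite map_f// mem_undup.
have PzxP : '[x - P, P - z] = 0.
  apply: dot_eq0C; rewrite dotBl /z {1}/P /proj !dot_suml big_map.
  rewrite big_seq big1 => [|i]; last first.
    by rewrite mem_undup => /xPe h; rewrite dotZl h mulr0.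
  by rewrite big_seq big1 ?subr0// => i /xPe h; rewrite dotZl h mulr0.
have := nsq_subproj x oF; rewrite -/P big_map => xP.
have := nsqD dot (x - P) (P - z); rewrite PzxP /= mul0rn addr0 subrKA => xzE.
have := nsq_ge0 dot (P - z); lra.
Qed.

Lemma trace_ge (T : H -> H) (F : seq I) : uniq F ->
  ((\sum_(i <- F) complex.Re '[T (e i), e i])%:E <= trace_op dot e T)%E.
Proof.
move=> uF; apply: esum_ge; exists [set` F]; first by split=> //; exact: finite_seq.
by rewrite -fsbig_seq// sumEFin.
Qed.

Lemma trace_le (T : H -> H) (K : R) :
  (forall F : seq I, uniq F -> \sum_(i <- F) complex.Re '[T (e i), e i] <= K) ->
  (trace_op dot e T <= K%:E)%E.
Proof.
move=> FK; apply: ge_ereal_sup => _ [X [/finite_seqP[s ->] _] <-].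
have -> : [set` s] = [set` undup s].
  by apply/seteqP; split=> i /=; rewrite mem_undup.
by rewrite -fsbig_seq ?undup_uniq// sumEFin lee_fin FK ?undup_uniq.
Qed.

(** Exchange the sums and apply Bessel's inequality to each h of [L] in the basis. *)
Lemma trace_proj_le L (T : H -> H) : ons L -> (forall x, T x = proj dot L x) ->
  (trace_op dot e T <= (size L)%:R%:E)%E.
Proof.
move=> oL TL; apply: trace_le => F uF.
have -> : \sum_(i <- F) complex.Re '[T (e i), e i] =
    \sum_(i <- F) \sum_(h <- L) csq '[h, e i].
  apply: eq_bigr => i _; rewrite TL dot_suml raddf_sum; apply: eq_bigr => h _.
  by rewrite dotZl (dotC dot h) -csqE /= csqC.
rewrite exchange_big /= -sum_seq1 big_seq [leRHS]big_seq.
apply: ler_sum => h hL; have := bessel h (basis_ons uF); rewrite big_map.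
move=> /le_trans; apply; move: oL => /andP[/allP L1 _].
by have /orP[/eqP->|/eqP->//] := L1 h hL; rewrite nsq0.
Qed.

Section DiagonalOperator.
Variables (B : {linear H -> H}) (d : I -> R).
Hypotheses (Bc : continuous B) (Be : forall i, B (e i) = (d i)%:C *: e i).

(** It holds on the span of the basis and extends by continuity of [B]; the constant 2 + 2 (d i)^2
    bounds the error made by replacing x with a nearby z. *)
Lemma diagonal_dot i x : '[B x, e i] = (d i)%:C * '[x, e i].
Proof.
apply/eqP; rewrite -subr_eq0; apply/eqP; apply: csq_eq0.
apply/eqP; rewrite eq_le csq_ge0 andbT.
apply: (@le0_eps _ _ (2 + d i ^+ 2 *+ 2)) => t t0.
have Bx : nbhs x [set y | nsq (B x - B y) < t] :=
  Bc (nbhs_nsq dot_norm (B x) t0).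
have : closure (linear_span e) x by rewrite e_basis.2.
move=> /(_ _ (filterI Bx (nbhs_nsq dot_norm x t0)))[_ [[s [c ->]]]].
set z := \sum_(j <- s) _ => -[/= Bxz xz].
have Bz : '[B z, e i] = (d i)%:C * '[z, e i].
  rewrite linear_sum !dot_suml mulr_sumr; apply: eq_bigr => j _.
  rewrite (linearZ_LR B) /= Be !dotZl e_basis.1.
  by case: eqP => [->|_]; rewrite ?mulr0// mulrCA.
have -> : '[B x, e i] - (d i)%:C * '[x, e i] =
    '[B x - B z, e i] - (d i)%:C * '[x - z, e i].
  by rewrite !dotBl mulrBr Bz opprB addrA subrK.
apply: le_trans (csqB_le _ _) _; rewrite csqM csq_real.
have h1 := cauchy_schwarz dot (B x - B z) (e i).
have h2 := cauchy_schwarz dot (x - z) (e i).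
rewrite (orthonormal_nsq e_basis.1) mulr1 in h1.
rewrite (orthonormal_nsq e_basis.1) mulr1 in h2.
have h3 : d i ^+ 2 * csq '[x - z, e i] <= d i ^+ 2 * t.
  by rewrite ler_wpM2l ?sqr_ge0// (le_trans h2)// ltW.
lra.
Qed.

(** By [diagonal_dot], [e i] is orthogonal to the range of [B], so its range projection is 0. *)
Lemma range_proj_perp_kernel i : d i = 0 -> range_proj_perp dot B (e i) = e i.
Proof.
move=> di; rewrite /range_proj_perp /range_proj.
rewrite (@orth_proj_eq _ _ _ _ _ 0) ?subr0//.
  by apply: subset_closure; exists 0 => //; rewrite linear0.
move=> z; apply: (dot_closure0 dot_norm) => _ [x _ <-]; apply: dot_eq0C.
by rewrite diagonal_dot di mul0r.
Qed.

Lemma trace_diagonal_ge (Z : seq I) : uniq Z -> (forall i, i \in Z -> d i = 0) ->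
  ((size Z)%:R%:E <= trace_op dot e (range_proj_perp dot B))%E.
Proof.
move=> uZ Z0; apply: le_trans (trace_ge _ uZ); rewrite lee_fin le_eqVlt.
apply/orP; left; apply/eqP; rewrite -sum_seq1; apply: eq_big_seq => i /Z0 di.
by rewrite range_proj_perp_kernel// -/(nsq (e i)) (orthonormal_nsq e_basis.1).
Qed.

End DiagonalOperator.
End Traces.

Unset Implicit Arguments.
Set Strict Implicit.
Set Printing Implicit Defensive.

Theorem theorem3p4 (R : realType) (H : completeNormedModType R[i])
  (dot : {dot H for conjC}) (dot_norm : induces_norm dot)
  (I : countType) (e : I -> H) (e_basis : orthonormal_basis dot e)
  (A B : H -> H)
  (A_compact : compact_op A) (A_pos : positive_op dot A)
  (B_orbit : cond_exp_orbit dot e A B)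
  (p : enat)
  (p_min : is_min_enat R
     [set n : enat | (trace_op dot e (range_proj_perp dot A) <=
        trace_op dot e (range_proj_perp dot B) + enat_ereal R n)%E] p) :
  approx_majorized p (sing_vals B) (sing_vals A).
Proof.
have [X [U [V [_ _ UV [UVK VUK] ->]]]] := B_orbit.
move=> [[[B_lin B_cont] B_diag] BX] {X}.
pose A' : {linear H -> H} :=
  HB.pack A (GRing.isLinear.Build _ _ _ _ A A_compact.1).
pose B' : {linear H -> H} := HB.pack B (GRing.isLinear.Build _ _ _ _ B B_lin).
have Ac : compact_op A' := A_compact.
have Apos : positive_op dot A' := A_pos.
have Bc : continuous B' := B_cont.
have V_iso x y : dot (V x) (V y) = dot x y.
  by rewrite -UV (_ : U (V x) = x)//; have := congr1 (fun F => F x) UVK.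
(* The eigenvalue is <U A V e_i, e_i> = <A V e_i, V e_i>, which is real by positivity. *)
have Be i : B' (e i) = (qf dot A' (V (e i)))%:C *: e i.
  have [c Bec] := B_diag i; have := BX i; rewrite Bec dotZl e_basis.1 eqxx mulr1.
  rewrite /= UV -[dot (A _) _]RRe_real; last by rewrite ger0_real.
  by move=> cE; rewrite -[LHS]/(B (e i)) Bec cE.
have V_parseval x (a : R) : 0 < a -> exists2 F : seq I, uniq F &
    nsq dot x - a <= \sum_(i <- F) csq (dot x (V (e i))).
  move=> a0; have [F uF] := basis_parseval dot_norm e_basis (U x) a0.
  have -> : nsq dot (U x) = nsq dot x.
    by rewrite /nsq UV (_ : V (U x) = x)//; have := congr1 (fun F => F x) VUK.
  by under eq_bigr do rewrite UV; exists F.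
have B_dot := diagonal_dot dot_norm e_basis Bc Be.
have [f [eigf f1 f0 fo fmax]] := spectral_sequence dot_norm Ac Apos.
have sA := is_sing_seq_compact_positive dot_norm Ac Apos eigf f1 fo fmax.
have [g [gE go gmax]] := diagonal_greedy dot_norm Ac Apos eigf f1 f0 fo fmax
  e_basis.1 V_iso Be.
have sB := is_sing_seq_diagonal dot_norm Ac Apos eigf f1 f0 fo fmax
  e_basis.1 (basis_parseval dot_norm e_basis) V_iso Be B_dot gE go gmax.
rewrite -[A]/(A' : H -> H) -[B]/(B' : H -> H) (sing_valsE sA) (sing_valsE sB).
have schur := schur_majorized dot_norm Ac Apos eigf f1 f0 fo fmax
  e_basis.1 V_iso V_parseval Be gE go gmax.
pose trA := trace_op dot e (range_proj_perp dot A').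
pose trB := trace_op dot e (range_proj_perp dot B').
(* The case of a positive index, under dim ker A > dim ker B + k. *)
have main k : (trB + k%:R%:E < trA)%E ->
    approx_majorized_fin k.+1 (fun n => qf dot B' (g n)) (fun n => qf dot A' (f n)).
  move=> trBA; pose Z := [set i | qf dot A' (V (e i)) = 0].
  have trZ (s : seq I) : uniq s -> (forall i, i \in s -> Z i) ->
      ((size s)%:R%:E <= trB)%E.
    by move=> us sZ; exact: (trace_diagonal_ge dot_norm e_basis Bc Be).
  (* An infinite Z would make trB infinite, against the strict inequality. *)
  have /finite_seqP[s ZE] : finite_set Z.
    apply: contrapT => /infinite_set_fsetP Zinf.
    have : (trB < +oo)%E.
      rewrite ltNge leye_eq; apply/negP => /eqP trBoo.
      by move: trBA; rewrite trBoo addye// ltNge leey.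
    apply/negP; rewrite -leNgt leye_eq; apply/eqP/eqyP => r _.
    have [F FZ Fr] := Zinf (Num.truncn r).+1.
    apply: le_trans (trZ F (fset_uniq _) FZ); rewrite lee_fin.
    by apply/ltW/(lt_le_trans (truncnS_gt _)); rewrite ler_nat.
  have ZP i : qf dot A' (V (e i)) = 0 -> i \in undup s.
    by move=> Zi; have : Z i by []; rewrite ZE /= mem_undup.
  have sZ i : i \in undup s -> Z i by rewrite mem_undup ZE.
  have us := undup_uniq s.
  (* Fewer than |Z| + k + 1 vectors spanning ker A would give trA <= |Z| + k <= trB + k. *)
  have [[L [sL oL TL]]|[L [sL oL TL cL]]] :=
      kernel_dichotomy dot A' (size (undup s) + k.+1).
    exact: (schur_approx_majorized dot_norm Ac Apos eigf f1 f0 fo fmax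
      e_basis.1 V_iso V_parseval Be gE go gmax us ZP oL TL sL).
  exfalso; move: trBA; apply/negP; rewrite -leNgt.
  have LA := range_proj_perp_ker dot_norm Ac Apos eigf f1 fo fmax oL TL cL.
  apply: le_trans (trace_proj_le e_basis oL LA) _.
  apply: (@le_trans _ _ ((size (undup s))%:R%:E + k%:R%:E)%E).
    by rewrite -EFinD lee_fin -natrD ler_nat -ltnS -addnS.
  by rewrite leeD2r// trZ.
have [Sp minp] := p_min.
(* If k + 1 <= p, then k violates the trace inequality by minimality of p, so [main] applies; this
   covers finite and infinite p alike. *)
have all_k k : (enat_ereal R (Some k) <= enat_ereal R p)%E ->
    approx_majorized_fin k (fun n => qf dot B' (g n)) (fun n => qf dot A' (f n)).
  case: k => [_|k kp]; last first.
    apply: main; rewrite ltNge; apply/negP => /(minp (Some k)) /(le_trans kp).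
    by rewrite lee_fin ler_nat ltnn.
  (* For index 0 the epsilon term is only slack, so every n will do. *)
  split=> // a a0; exists 0%N => n _; rewrite addn0.
  apply: le_trans (schur.1 n) _; rewrite lerDl mulr_ge0 ?(ltW a0)//.
  exact: qf_ge0.
case: p {p_min Sp minp} all_k => [k|] all_k /=; first exact: all_k.
by move=> k; apply: all_k; rewrite leey.
Qed.
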